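(* For $a\in\mathbb{R}$ let $$g(a) := \sup_{y\ge 0}\left|e^{iay}-e^{-y}\right| .$$ Any eigenvalue $\lambda=|\lambda|e^{i\theta}\in\mathbb{C}\setminus[0,\infty)$ of the operator $-\partial^2-V$ in $L^2(0,\infty)$ with Dirichlet boundary conditions satisfies $$|\lambda|^{1/2}\le \frac12\, g(\cot(\theta/2))\int_0^\infty |V(x)|\,dx .$$ This bound is sharp in the following sense: for any given $m>0$ and $\theta\in(0,2\pi)$ there are $c\in\mathbb{C}$ and $b>0$ such that for $V(x)=c\,\delta(x-b)$ one has $|c|=\int_0^\infty|V(x)|\,dx=m$ and the unique eigenvalue of $-\partial^2-V$ (in $L^2(0,\infty)$ with Dirichlet boundary conditions) is given by $\frac{m^2}{4}\,g(\cot(\theta/2))^2\,e^{i\theta}$, that is, equality is attained in the bound above.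
   Context: The potential $V$ on $(0,\infty)$ is complex-valued with $\int_0^\infty|V(x)|\,dx<\infty$, or more generally a finite complex Borel measure on $(0,\infty)$; an integrable function $V$ is identified with the measure $V(x)\,dx$, and $\delta(x-b)$ denotes the Dirac unit mass at $b$. The expression $\int_0^\infty|V(x)|\,dx$ denotes the $L^1$-norm of $V$, respectively the total variation of the measure $V$. The operator $-\partial^2-V$ in $L^2(0,\infty)$ with Dirichlet boundary conditions ($\psi(0)=0$) is defined in the quadratic form sense: it is the m-sectorial operator associated with the form $\psi\mapsto\int_0^\infty|\psi'(x)|^2\,dx-\int_{(0,\infty)}|\psi|^2\,dV$ with form domain $H^1_0(0,\infty)$ (elements of which are identified with their continuous representatives). The argument $\theta$ of $\lambda\in\mathbb{C}\setminus[0,\infty)$ is taken in $(0,2\pi)$.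
   Formalization: Attained equality is claimed only for θ ≠ π: at θ = π the supremum g(0) = 1 is not attained and no c, b > 0 give equality; there it is shown instead that for every ε > 0 some c δ(x−b) with |c| = m has a unique eigenvalue, negative, whose |λ|^{1/2} exceeds (1/2) g(0) m − ε. *)

(* Defs.v *)
From HB Require Import structures.
From mathcomp Require Import all_boot all_order all_algebra.
From mathcomp Require Import complex.
From mathcomp Require Import all_classical all_reals all_analysis.

Set Implicit Arguments.
Unset Strict Implicit.
Unset Printing Implicit Defensive.

Import Order.TTheory GRing.Theory Num.Theory.
Import numFieldNormedType.Exports.

Local Open Scope classical_set_scope.
Local Open Scope ring_scope.
Local Open Scope complex_scope.

Notation halfline R := (`]0%R, +oo[%classic : set R).

(* R-valued modulus; [`|z|] on [R[i]] is the same number seen in [R[i]]. *)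
Definition cabs (R : realType) (z : R[i]) : R := ComplexField.Normc.normc z.

Definition expi (R : realType) (t : R) : R[i] := cos t +i* sin t.

Definition cot (R : realType) (t : R) : R := cos t / sin t.

Definition g (R : realType) (a : R) : R :=
  sup [set cabs (expi (a * y) - (expR (- y))%:C) | y in [set y : R | 0 <= y]].

Section complex_integral.
Context d (T : measurableType d) (R : realType).
Implicit Types (D : set T).

Definition cintegral (mu : {measure set T -> \bar R}) D (f : T -> R[i]) :
    R[i] :=
  (\int[mu]_(x in D) complex.Re (f x)) +i* (\int[mu]_(x in D) complex.Im (f x)).

Lemma hahn_sets_proof (nu : {charge set T -> \bar R}) :
  exists PN : set T * set T, hahn_decomposition nu PN.1 PN.2.
Proof. by have [P [N PN]] := Hahn_decomposition nu; exists (P, N). Qed.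

Definition hahn_setsP (nu : {charge set T -> \bar R}) :=
  projT2 (cid (hahn_sets_proof nu)).

(* The Jordan decomposition does not depend on the chosen Hahn sets. *)
Definition charge_integral (nu : {charge set T -> \bar R}) D (f : T -> R) : R :=
  (\int[jordan_pos (hahn_setsP nu)]_(x in D) f x) -
  (\int[jordan_neg (hahn_setsP nu)]_(x in D) f x).

(* A charge is finite on every measurable set, so this is the decomposition of
   a finite complex measure into its real and imaginary parts. *)
Record complex_measure := ComplexMeasure {
  cm_re : {charge set T -> \bar R} ;
  cm_im : {charge set T -> \bar R} }.

Definition cm_val (V : complex_measure) (A : set T) : R[i] :=
  fine (cm_re V A) +i* fine (cm_im V A).

Definition cm_integral (V : complex_measure) D (f : T -> R[i]) : R[i] :=
  (charge_integral (cm_re V) D (fun x => complex.Re (f x)) -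
   charge_integral (cm_im V) D (fun x => complex.Im (f x))) +i*
  (charge_integral (cm_re V) D (fun x => complex.Im (f x)) +
   charge_integral (cm_im V) D (fun x => complex.Re (f x))).

Definition cm_variation (V : complex_measure) D : \bar R :=
  ereal_sup [set v | exists (n : nat) (A : 'I_n -> set T),
    [/\ forall i, measurable (A i), trivIset setT A, \bigcup_i A i = D
      & v = (\sum_(i < n) cabs (cm_val V (A i)))%:E]].

Definition cdelta (c : R[i]) (b : T) : complex_measure :=
  let delta := charge_of_finite_measure (\d_b : {finite_measure set T -> \bar R})
  in ComplexMeasure (cscale (complex.Re c) delta) (cscale (complex.Im c) delta).

End complex_integral.

Section halfline_spaces.
Context (R : realType).
Local Notation mu := (@lebesgue_measure R).
Local Notation D := (halfline R).

Record L1_potential := L1Potential {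
  L1_fun :> R -> R[i] ;
  L1_re : mu.-integrable D (fun x => (complex.Re (L1_fun x))%:E) ;
  L1_im : mu.-integrable D (fun x => (complex.Im (L1_fun x))%:E) }.

Definition L1_norm (v : L1_potential) : R := \int[mu]_(x in D) cabs (v x).

Lemma L1_restrict (f : R -> R) : mu.-integrable D (fun x => (f x)%:E) ->
  mu.-integrable [set: R] ((fun x => (f x)%:E) \_ D).
Proof. by move=> ?; apply/(integrable_mkcond _ _).1 => //. Qed.

(* The measure V(x) dx, carried by the half-line. *)
Definition measure_of_L1 (v : L1_potential) :
    complex_measure (measurableTypeR R) R :=
  ComplexMeasure (induced_charge (L1_restrict (L1_re v)))
                 (induced_charge (L1_restrict (L1_im v))).

Definition square_integrable (f : R -> R[i]) :=
  [/\ measurable_fun D (fun x => complex.Re (f x)),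
      measurable_fun D (fun x => complex.Im (f x))
    & mu.-integrable D (fun x => (cabs (f x) ^+ 2)%:E)].

(* H^1_0(0,oo): the locally absolutely continuous functions on [0,oo[ that
   vanish at 0 and are, together with their derivative, in L^2.  The derivative
   is part of the data, being determined up to a null set.  Values at negative
   arguments are irrelevant. *)
Record H10 := MkH10 {
  H10_fun :> R -> R[i] ;
  H10_deriv : R -> R[i] ;
  H10_L2 : square_integrable H10_fun ;
  H10_deriv_L2 : square_integrable H10_deriv ;
  H10_at0 : H10_fun 0 = 0 ;
  H10_primitive : forall x y, 0 <= x -> x <= y ->
    H10_fun y - H10_fun x = cintegral mu `]x, y] H10_deriv }.

(* Sesquilinear form (linear in the first argument) whose quadratic form is
   psi |-> \int |psi'|^2 - \int |psi|^2 dV. *)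
Definition schrodinger_form (V : complex_measure (measurableTypeR R) R)
    (psi phi : H10) : R[i] :=
  cintegral mu D (fun x => H10_deriv psi x * (H10_deriv phi x)^*) -
  cm_integral V D (fun x => psi x * (phi x)^*).

(* Graph of the m-sectorial operator associated with the form (first
   representation theorem): psi is in the operator domain and is mapped to f. *)
Definition schrodinger_op (V : complex_measure (measurableTypeR R) R)
    (psi : H10) (f : R -> R[i]) : Prop :=
  square_integrable f /\
  forall phi : H10,
    schrodinger_form V psi phi = cintegral mu D (fun x => f x * (phi x)^*).

Definition is_eigenvalue (V : complex_measure (measurableTypeR R) R)
    (lam : R[i]) : Prop :=
  exists psi : H10, (exists2 x, 0 < x & psi x != 0) /\
    schrodinger_op V psi (fun x => lam * psi x).

End halfline_spaces.

(* Main.v *)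
(** Write [lam = - z ^+ 2] with [Re z < 0].  Testing the weak equation against
    the Green function [G(x, .)] of [- d^2/dx^2 - lam] gives
    [psi(x) = \int G(x, y) psi(y) dV(y)], so evaluating at a point where [|psi|]
    is nearly maximal yields [1 <= sup |G| * |V|(0, oo)].  The supremum is taken
    on the diagonal, [G(x, x) = (e^(2zx) - 1) / (2z)], and
    [|e^(2zx) - 1| <= g(cot (theta / 2))] because [2zx = - s + i a s] with
    [s >= 0] and [a = cot (theta / 2)].

    For [V = c delta_b] the eigenvalues are the [- z ^+ 2] with
    [c (e^(2zb) - 1) = 2z].  One chooses [b] and [c] such that [w0 = 2zb] maximizes
    [|e^w - 1|] on the ray [w = - s + i a s].  The map [w |-> (e^w - 1) / w] is not
    injective on the left half-plane, but at a maximizer the vanishing of the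
    derivative means that [arg ((e^w0 - 1) / w0) = Im w0 - pi / 2], and this is
    what excludes a second solution. *)
Require Import Defs.
From mathcomp Require Import all_boot all_order all_algebra.
From mathcomp Require Import complex.
From mathcomp Require Import all_classical all_reals all_analysis.
From mathcomp Require Import measurable_realfun.
From mathcomp Require Import ring lra.
Import Order.TTheory GRing.Theory Num.Theory.
Import numFieldNormedType.Exports.
Local Open Scope classical_set_scope.
Local Open Scope ring_scope.
Local Open Scope complex_scope.

Set Implicit Arguments.
Unset Strict Implicit.
Unset Printing Implicit Defensive.

(** * Critical points of [|e^(i a y) - e^(-y)|] *)

Section elementary.
Context {R : realType}.
Implicit Types a t x y r : R.

(** How criticality excludes a second solution: for [(e^w - 1) / w = r e^(i al)] with
    [w = - y' + i t'], the system for [y'] and [t'] oscillates in [t'], so the phase is located by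
    windows. A phase [t' <= al] contradicts the real part; a phase beyond [al + pi / 2] would have
    to complete a full turn, which makes [r] too small; within the remaining quarter turn two
    solutions can be compared directly. This needs [0 < al < pi / 2], that is [theta < pi]. The case
    [theta > pi] follows by conjugation. At [theta = pi] the ray is real and [1 - e^(- s)] only
    tends to its supremum [1], so equality is approached by letting [b] grow.

    Uniqueness of the eigenvalue also requires that no [lam >= 0] is one. There the free equation
    has no decaying solution to build a Green function from, and compactly supported hats take its
    place. All test functions are glued from explicit free solutions, so an eigenfunction is only
    ever handled through the weak equation and needs no further regularity. *)

Lemma sin_sub_ge (s t : R) : 0 <= t -> t <= s -> s <= pi / 2 ->
  t * cos s <= sin s - sin (s - t).
Proof.
move=> t0 ts spi.
have sts : s - t <= s by rewrite lerBlDr lerDl.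
have [c] := @MVT_segment R sin cos _ _ sts (fun x _ => is_derive_sin x)
  (continuous_subspaceT (@continuous_sin R)).
rewrite in_itv /= => /andP[c1 c2] ->.
rewrite mulrC (_ : s - (s - t) = t); last by ring.
rewrite ler_wpM2r//.
have [->//|cs] := eqVneq c s.
rewrite ltW// ltr_cos ?in_itv/=; first by rewrite lt_neqAle cs.
- by apply/andP; split; have := @pi_gt0 R; lra.
- by apply/andP; split; have := @pi_gt0 R; lra.
Qed.

Lemma sin_le_id t : 0 <= t -> t <= pi / 2 -> sin t <= t.
Proof.
move=> t0 tpi.
have [c _] := @MVT_segment R sin cos _ _ t0 (fun x _ => is_derive_sin x)
  (continuous_subspaceT (@continuous_sin R)).
 rewrite sin0 !subr0 => ->.
by rewrite ler_piMl// cos_le1.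
Qed.

Lemma expRN_onep x : 0 <= x -> expR (- x) * (1 + x) <= 1.
Proof.
move=> x0; rewrite expRN mulrC ler_pdivrMr ?expR_gt0// mul1r; exact: expR_ge1Dx.
Qed.

(** The factor [1 + d] removes the exponential, since [expR (- d) * (1 + d) < 1], and
    [h * sin h >= sin h ^+ 2 = 1 - cos h ^+ 2] leaves a polynomial inequality in [d] and [cos h]. It
    serves twice: to place the maximizer of [gfun] beyond a quarter turn, and to separate two
    critical solutions. *)
Lemma mul_expRN_lt (d h : R) : 0 < d -> 0 <= h -> h <= pi / 2 ->
  d * expR (- d) < d * cos h + h * sin h.
Proof.
move=> d0 h0 hpi.
have c0 : 0 <= cos h by apply: cos_ge0_pihalf; apply/andP; split => //;
  have := @pi_gt0 R; lra.
have s0 : 0 <= sin h by apply: sin_ge0_pi; apply/andP; split => //;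
  have := @pi_gt0 R; lra.
have sh : sin h <= h by exact: sin_le_id.
have cs := cos2Dsin2 h.
have c1 := cos_le1 h.
have E1 : expR (- d) * (1 + d) < 1.
  by rewrite expRN mulrC ltr_pdivrMr ?expR_gt0// mul1r; apply: expR_gt1Dx;
    rewrite gt_eqF.
set c := cos h in c0 cs c1 *; set s := sin h in s0 sh cs *.
set e := expR (- d) in E1 *.
have : d * e * (1 + d) < (d * c + h * s) * (1 + d).
  rewrite -mulrA; apply: (@lt_le_trans _ _ d); first by rewrite gtr_pMr.
  have hs : s ^+ 2 <= h * s by rewrite expr2 ler_wpM2r.
  have : (d * c + s ^+ 2) * (1 + d) <= (d * c + h * s) * (1 + d).
    by rewrite ler_pM2r; lra.
  apply: le_trans.
  have -> : s ^+ 2 = 1 - c ^+ 2 by lra.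
  rewrite -subr_ge0 (_ : _ - _ = d * (c * (1 - c)) + (1 - c ^+ 2) + d ^+ 2 * c);
    last by ring.
  have t1 : 0 <= d * (c * (1 - c)) by rewrite !mulr_ge0 ?subr_ge0// ltW.
  have t2 : c ^+ 2 <= 1 by rewrite expr_le1.
  have t3 : 0 <= d ^+ 2 * c by rewrite mulr_ge0 ?sqr_ge0.
  lra.
by rewrite ltr_pM2r; lra.
Qed.

(* The sign of the imaginary part of [(e^w - 1) / w], for [w = - y + i t]. *)
Lemma im_divdiff_le0 (y t : R) : 0 < y -> t <= 0 ->
  t - expR (- y) * (t * cos t + y * sin t) <= 0.
Proof.
move=> y0 t0.
have E := expRN_onep (ltW y0).
have e0 := expR_gt0 (- y).
suff : - (t * cos t + y * sin t) <= - t * (1 + y).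
  move=> h.
  have : expR (- y) * - (t * cos t + y * sin t) <= - t.
    apply: (@le_trans _ _ (expR (- y) * (- t * (1 + y)))).
      by rewrite ler_wpM2l// ltW.
    by rewrite mulrCA ler_piMr// oppr_ge0.
  lra.
have c1 := cos_le1 t.
have h1 : - t * cos t <= - t by rewrite ler_piMr// oppr_ge0.
suff : - sin t <= - t by move=> h; have := ler_wpM2l (ltW y0) h; lra.
rewrite -sinN.
have [h|h] := leP (- t) (pi / 2); first by apply: sin_le_id; lra.
have := sin_le1 (- t); have := @pi_ge2 R; lra.
Qed.

(** On [[pi / 2, pi]] the cosine is nonpositive and on [[pi, 2 pi]] the sine is, so beyond [pi / 2]
    both become positive only after a full turn. *)
Lemma ge_2pi (u : R) : pi / 2 < u -> 0 < sin u -> 0 < cos u -> 2 * pi <= u.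
Proof.
move=> u1 s0 c0; rewrite leNgt; apply/negP => u2.
have [h|h] := leP u pi.
  have := @cos_ge0_pihalf R (pi - u).
  have -> : - (pi / 2) <= pi - u <= pi / 2 by apply/andP; have := @pi_gt0 R; lra.
  by move=> /(_ isT); rewrite addrC cosDpi cosN; lra.
have := @sin_ge0_pi R (u - pi).
have -> : 0 <= u - pi <= pi by apply/andP; lra.
move=> /(_ isT).
by have := sinDpi (u - pi); rewrite subrK; lra.
Qed.

(* With [w = - y' + i t'], the two equations for [y'] and [t'] below say that
   [e^w - 1 = r e^(i al) w]; those for [y] say the same of [- y + i (al + pi / 2)],
   a critical point of [|e^w - 1|] along its ray. *)
Lemma critical_gt0 (al r y' t' : R) : 0 < sin al -> 0 < r -> 0 < y' ->
  r * y' = cos al - expR (- y') * cos (t' - al) ->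
  r * t' = sin al + expR (- y') * sin (t' - al) -> 0 < t'.
Proof.
move=> sa0 r0 y'0 ry' rt'; have csa := cos2Dsin2 al.
rewrite ltNge; apply/negP => t'0.
have := im_divdiff_le0 y'0 t'0.
(* This is [|w|^2] times the imaginary part of [(e^w - 1) / w], hence [r sin al |w|^2], which is
   positive. *)
have -> : t' - expR (- y') * (t' * cos t' + y' * sin t') =
          r * sin al * (y' ^+ 2 + t' ^+ 2).
  have ec : expR (- y') * cos t' =
    (cos al - r * y') * cos al - (r * t' - sin al) * sin al.
    have -> : cos t' = cos (t' - al) * cos al - sin (t' - al) * sin al
      by rewrite -cosD subrK.
    rewrite ry' rt'; ring.
  have es : expR (- y') * sin t' =
    (cos al - r * y') * sin al + (r * t' - sin al) * cos al.
    have -> : sin t' = sin (t' - al) * cos al + cos (t' - al) * sin al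
      by rewrite -sinD subrK.
    rewrite ry' rt'; ring.
  rewrite mulrDr ![expR _ * (_ * _)]mulrCA ec es.
  apply/eqP; rewrite -subr_eq0; apply/eqP.
  transitivity (t' * (1 - (cos al ^+ 2 + sin al ^+ 2))); first by ring.
  by rewrite csa subrr mulr0.
rewrite leNgt => /negP; apply.
by rewrite !mulr_gt0// ltr_pwDl ?sqr_ge0// exprn_gt0.
Qed.

(** If [0 < t' <= al], the last equation and the concavity of the sine give [r >= cos al], hence
    [y <= 1]. The equation for [y'], with [cos (t' - al) >= cos al] and [1 - y' < expR (- y')],
    gives [r * y' < y' * cos al = r * y * y'], hence [y > 1]. *)
Lemma critical_gt_arg (al y r y' t' : R) : 0 < al -> al < pi / 2 -> 0 < r -> 0 < y' ->
  r * y = cos al ->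
  r * y' = cos al - expR (- y') * cos (t' - al) ->
  r * t' = sin al + expR (- y') * sin (t' - al) -> al < t'.
Proof.
move=> al0 alpi r0 y'0 ry ry' rt'.
have pi2 := @pi_ge2 R.
have ca0 : 0 < cos al by apply: cos_gt0_pihalf; apply/andP; lra.
have sa0 : 0 < sin al by apply: sin_gt0_pihalf; apply/andP; lra.
have e0' := expR_gt0 (- y').
have e1' : expR (- y') < 1 by rewrite expR_lt1 oppr_lt0.
have t'0 : 0 < t' := critical_gt0 sa0 r0 y'0 ry' rt'.
rewrite ltNge; apply/negP => t1.
have s1 := sin_sub_ge (ltW t'0) t1 (ltW alpi).
have c1 : cos al <= cos (t' - al).
  rewrite -(cosN (t' - al)) opprB.
  have [->|nz] := eqVneq t' 0; first by rewrite subr0.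
  rewrite ltW// ltr_cos ?in_itv/=; [lra|by apply/andP; lra..].
have h1 : cos al <= r.
  rewrite -(ler_pM2l t'0) (mulrC _ r) rt' -opprB sinN mulrN.
  apply: le_trans s1 _; rewrite lerD2l lerN2 ler_piMl ?(ltW e1')//.
  by apply: sin_ge0_pi; apply/andP; lra.
have h2 : y <= 1 by rewrite -(ler_pM2l r0) mulr1 ry.
have h3 : (1 - y') * cos al < cos al - r * y'.
  have w1 : 1 - y' < expR (- y') by apply: expR_gt1Dx; rewrite oppr_eq0 gt_eqF.
  have w2 : (1 - y') * cos al < expR (- y') * cos al by rewrite ltr_pM2r.
  have w3 : expR (- y') * cos al <= expR (- y') * cos (t' - al) by rewrite ler_pM2l.
  lra.
have : r * y' < r * y * y' by rewrite ry; lra.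
have : r * y * y' <= r * y' by rewrite ler_pM2r// ler_piMr// ltW.
lra.
Qed.

(** Put [h = al + pi / 2 - t'] and [d = y - y']. Subtracting the equations gives
    [r * h = expR (- y) - expR (- y') * cos h] and [r * d = expR (- y') * sin h]. Eliminating [r]
    yields [d * expR (- d) = d * cos h + h * sin h], which [mul_expRN_lt] forbids unless [h = 0]. *)
Lemma critical_le_unique (al y r y' t' : R) : 0 < r ->
  r * y = cos al -> r * (al + pi / 2) = sin al + expR (- y) ->
  r * y' = cos al - expR (- y') * cos (t' - al) ->
  r * t' = sin al + expR (- y') * sin (t' - al) ->
  al < t' -> t' <= al + pi / 2 -> y' = y /\ t' = al + pi / 2.
Proof.
move=> r0 ry rt ry' rt' t1 t2.
have pi2 := @pi_ge2 R; have e0' := expR_gt0 (- y').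
set h := al + pi / 2 - t'.
have uE : t' - al = pi / 2 - h by rewrite /h; lra.
have sE : sin (t' - al) = cos h
  by rewrite uE sinB sin_pihalf cos_pihalf mul1r mul0r subr0.
have cE : cos (t' - al) = sin h
  by rewrite uE cosB sin_pihalf cos_pihalf mul1r mul0r add0r.
move: (rt') (ry'); rewrite sE cE => rt1 ry1.
have h0 : 0 <= h by rewrite /h; lra.
have hpi : h < pi / 2 by rewrite /h; lra.
have rh : r * h = expR (- y) - expR (- y') * cos h by rewrite /h mulrBr rt rt1; ring.
have rd : r * (y - y') = expR (- y') * sin h by rewrite mulrBr ry ry1; ring.
have [hE|hn] := eqVneq h 0.
  move: rd; rewrite hE sin0 mulr0 => /eqP; rewrite mulf_eq0 gt_eqF//= subr_eq0 =>
    /eqP <-.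
  by split => //; move: hE; rewrite /h; lra.
exfalso.
have hp : 0 < h by rewrite lt_def hn.
have sh0 : 0 < sin h by apply: sin_gt0_pihalf; apply/andP; split.
have d0 : 0 < y - y' by rewrite -(pmulr_rgt0 _ r0) rd mulr_gt0.
have := mul_expRN_lt d0 h0 (ltW hpi).
rewrite -(ltr_pM2l e0').
have eE : expR (- y) = expR (- y') * expR (- (y - y'))
  by rewrite -expRD; congr expR; ring.
have : (y - y') * (r * h) = h * (r * (y - y')) by ring.
rewrite rh rd eE; lra.
Qed.

(** Were [u = t' - al > pi / 2], comparison with the reference solution would make [sin u] and
    [cos u] positive, hence [u >= 2 pi]. So long a phase makes [r], and with it [sin al], small;
    thus [cos al > 1 / 2] and [y * E >= 1] for [E = expR (- y')]. Then
    [y < y' + y * E <= y * E * (1 + y') <= y], a contradiction. *)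
Lemma critical_le (al y r y' t' : R) : 0 < al -> al < pi / 2 -> 0 < y -> 0 < y' ->
  0 < r ->
  r * y = cos al -> r * (al + pi / 2) = sin al + expR (- y) ->
  r * y' = cos al - expR (- y') * cos (t' - al) ->
  r * t' = sin al + expR (- y') * sin (t' - al) -> t' <= al + pi / 2.
Proof.
move=> al0 alpi y0 y'0 r0 ry rt ry' rt'.
have pi2 := @pi_ge2 R.
have ca0 : 0 < cos al by apply: cos_gt0_pihalf; apply/andP; lra.
have sa0 : 0 < sin al by apply: sin_gt0_pihalf; apply/andP; lra.
have csa := cos2Dsin2 al.
have E1 := expRN_onep (ltW y'0); have e0' := expR_gt0 (- y').
have e1' : expR (- y') < 1 by rewrite expR_lt1 oppr_lt0.
rewrite leNgt; apply/negP => t2.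
have e0 := expR_gt0 (- y).
set u := t' - al in ry' rt'.
have t'E : t' = u + al by rewrite /u subrK.
have h1 : r * (al + pi / 2) < r * t' by rewrite ltr_pM2l.
have q0 : expR (- y) < expR (- y') * sin u by lra.
have su0 : 0 < sin u by rewrite -(pmulr_rgt0 _ e0'); lra.
have yy' : y' < y.
  have : expR (- y) < expR (- y').
    by apply: lt_le_trans q0 _; rewrite ler_piMr ?sin_le1// ltW.
  by rewrite ltr_expR ltrN2.
have cu0 : 0 < cos u.
  rewrite -(pmulr_rgt0 _ e0').
  have : r * y' < r * y by rewrite ltr_pM2l.
  lra.
have u2 : 2 * pi <= u by apply: ge_2pi => //; rewrite /u; lra.
(* The phases [t'] and [al + pi / 2] differ by at least [3 pi / 2]. *)
have q1 : r * (3 * (pi / 2)) < expR (- y') * sin u.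
  have : r * (2 * pi + al) <= r * t' by rewrite ler_pM2l//; lra.
  lra.
have q2 : 3 / 2 * sin al < expR (- y') * sin u.
  have : r * (al + pi / 2) <= r * pi by rewrite ler_pM2l//; lra.
  lra.
have su1 := sin_le1 u.
have q3 : expR (- y') * sin u <= expR (- y') by rewrite ler_piMr// ltW.
have q4 : sin al < sin u.
  rewrite -(ltr_pM2l e0').
  have : expR (- y') * sin al <= sin al by rewrite ler_piMl// ltW.
  lra.
have csu := cos2Dsin2 u.
have cuca : cos u < cos al.
  rewrite -(ltr_pXn2r (n := 2))// ?nnegrE ?(ltW ca0) ?(ltW cu0)//.
  have : sin al ^+ 2 < sin u ^+ 2 by rewrite ltr_pXn2r// nnegrE ltW.
  lra.
have ca3 : 1 / 2 < cos al.
  rewrite ltNge; apply/negP => cle.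
  have : cos al * cos al <= 1 / 2 * (1 / 2) by apply: ler_pM => //; exact: ltW.
  have : sin al * sin al <= 2 / 3 * (2 / 3) by apply: ler_pM; clear -sa0 q2 q3 e1'; lra.
  clear -csa; lra.
set E := expR (- y') in E1 e0' e1' q1 q3 ry' *.
have yE : 1 <= y * E.
  have : y * (r * (3 * (pi / 2))) <= y * E by rewrite ler_pM2l//; lra.
  have -> : y * (r * (3 * (pi / 2))) = cos al * (3 * (pi / 2)) by rewrite -ry; ring.
  have : 1 / 2 * 3 <= cos al * (3 * (pi / 2)) by apply: ler_pM; lra.
  lra.
have k1 : y - y' < y * E.
  rewrite -(ltr_pM2l r0).
  have -> : r * (y * E) = E * cos al by rewrite -ry; ring.
  have : E * cos u < E * cos al by rewrite ltr_pM2l.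
  rewrite mulrBr ry; lra.
have k2 : y' * (y * E) >= y' by rewrite ler_peMr// ltW.
have k3 : y * (E * (1 + y')) <= y by rewrite ler_piMr// ltW.
lra.
Qed.

Lemma critical_unique (al y r y' t' : R) :
  0 < al -> al < pi / 2 -> 0 < y -> 0 < y' ->
  r * y = cos al -> r * (al + pi / 2) = sin al + expR (- y) ->
  r * y' = cos al - expR (- y') * cos (t' - al) ->
  r * t' = sin al + expR (- y') * sin (t' - al) ->
  y' = y /\ t' = al + pi / 2.
Proof.
move=> al0 alpi y0 y'0 ry rt ry' rt'.
have r0 : 0 < r.
  rewrite -(pmulr_lgt0 _ y0) ry; apply: cos_gt0_pihalf; apply/andP; split=> //.
  by have := @pi_gt0 R; lra.
have gt := critical_gt_arg al0 alpi r0 y'0 ry ry' rt'.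
have le := critical_le al0 alpi y0 y'0 r0 ry rt ry' rt'.
exact: critical_le_unique r0 ry rt ry' rt' gt le.
Qed.

(** * The modulus and the supremum defining [g] *)

Lemma cabsE (z : R[i]) : cabs z = Num.sqrt (complex.Re z ^+ 2 + complex.Im z ^+ 2).
Proof. by case: z. Qed.

Lemma cabs_ge0 (z : R[i]) : 0 <= cabs z.
Proof. by rewrite cabsE sqrtr_ge0. Qed.

Lemma cabs_sqr (z : R[i]) : cabs z ^+ 2 = complex.Re z ^+ 2 + complex.Im z ^+ 2.
Proof. by rewrite cabsE sqr_sqrtr// addr_ge0 ?sqr_ge0. Qed.

Lemma cabs_eq0 (z : R[i]) : (cabs z == 0) = (z == 0).
Proof.
apply/eqP/eqP => [|->]; last exact: ComplexField.Normc.normc0.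
exact: ComplexField.Normc.eq0_normc.
Qed.

Lemma cabsM (z w : R[i]) : cabs (z * w) = cabs z * cabs w.
Proof. exact: ComplexField.Normc.normcM. Qed.

Lemma cabsV (z : R[i]) : cabs z^-1 = (cabs z)^-1.
Proof. exact: ComplexField.Normc.normcV. Qed.

Lemma cabsD (z w : R[i]) : cabs (z + w) <= cabs z + cabs w.
Proof. exact: le_normcD. Qed.

Lemma cabsN (z : R[i]) : cabs (- z) = cabs z.
Proof. exact: normcN. Qed.

Lemma cabsR (x : R) : cabs x%:C = `|x|.
Proof. by rewrite cabsE /= expr0n/= addr0 sqrtr_sqr. Qed.

Lemma cabsJ (z : R[i]) : cabs z^* = cabs z.
Proof. by rewrite !cabsE; case: z => a b /=; rewrite sqrrN. Qed.

Lemma cabs_expi (t : R) : cabs (expi t) = 1.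
Proof. by rewrite cabsE /= cos2Dsin2 sqrtr1. Qed.

Lemma Re_le_cabs (z : R[i]) : `|complex.Re z| <= cabs z.
Proof. by rewrite cabsE -sqrtr_sqr ler_wsqrtr// lerDl sqr_ge0. Qed.

Lemma Im_le_cabs (z : R[i]) : `|complex.Im z| <= cabs z.
Proof. by rewrite cabsE -sqrtr_sqr ler_wsqrtr// lerDr sqr_ge0. Qed.

Lemma cabs_le (z : R[i]) : cabs z <= `|complex.Re z| + `|complex.Im z|.
Proof.
rewrite cabsE -[leRHS]ger0_norm ?addr_ge0// -sqrtr_sqr ler_wsqrtr//.
rewrite -(real_normK (num_real (complex.Re z))) -(real_normK (num_real (complex.Im z))).
by rewrite sqrrD lerD2r lerDl mulrn_wge0// mulr_ge0.
Qed.

Definition gfun a y : R := cabs (expi (a * y) - (expR (- y))%:C).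

Lemma gfun_ge0 a y : 0 <= gfun a y. Proof. exact: cabs_ge0. Qed.

Lemma gfun_sqr a y :
  gfun a y ^+ 2 = 1 - 2 * expR (- y) * cos (a * y) + expR (- y) ^+ 2.
Proof.
rewrite /gfun cabs_sqr /= subr0 sqrrB.
have := cos2Dsin2 (a * y); lra.
Qed.

Lemma gfunN a y : gfun (- a) y = gfun a y.
Proof.
by apply/eqP; rewrite -(eqrXn2 (n := 2))// ?gfun_ge0// !gfun_sqr mulNr cosN.
Qed.

Lemma gN a : g (- a) = g a.
Proof.
rewrite /g; congr (sup _); apply/seteqP; split => _ [y y0 <-]; exists y => //;
  exact/esym/gfunN || exact/gfunN.
Qed.

Lemma gfun_le a y : 0 <= y -> gfun a y <= 1 + expR (- y).
Proof.
move=> y0; apply: le_trans (cabsD _ _) _.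
by rewrite cabs_expi cabsN cabsR ger0_norm ?expR_ge0.
Qed.

Lemma gfun_le_g a y : 0 <= y -> gfun a y <= g a.
Proof.
move=> y0; apply: ub_le_sup; last by exists y.
exists 2 => _ [x x0 <-]; apply: (le_trans (gfun_le a x0)).
have : expR (- x) <= 1 by rewrite expR_le1 oppr_le0.
lra.
Qed.

Lemma g_gt0 a : 0 < g a.
Proof.
apply: (@lt_le_trans _ _ (gfun a 1)); last exact: gfun_le_g.
rewrite lt_def gfun_ge0 andbT cabs_eq0 subr_eq0; apply/eqP => e1.
have := cabs_expi (a * 1); rewrite e1 cabsR ger0_norm ?expR_ge0// => {}e1.
by have : expR (- 1) < 1 :> R; [rewrite expR_lt1; lra|rewrite e1 ltxx].
Qed.

Lemma is_derive_gfun_sqr a x : is_derive x 1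
  (fun y => 1 - 2 * expR (- y) * cos (a * y) + expR (- y) ^+ 2)
  (2 * expR (- x) * (cos (a * x) + a * sin (a * x)) - 2 * expR (- x) ^+ 2).
Proof.
apply: is_derive_eq.
rewrite /GRing.scale/=; ring.
Qed.

Lemma g_attained a : 0 < a -> exists y : R, [/\ 0 < y, g a = gfun a y,
   cos (a * y) + a * sin (a * y) = expR (- y) & pi / 2 < a * y < pi].
Proof.
move=> a0.
have pi0 := @pi_gt0 R.
set h := fun y => 1 - 2 * expR (- y) * cos (a * y) + expR (- y) ^+ 2.
have hE y : h y = gfun a y ^+ 2 by rewrite gfun_sqr.
have ch : continuous h.
  by move=> x; apply: differentiable_continuous; apply/derivable1_diffP;
    case: (is_derive_gfun_sqr a x).
(* Here [e^(i a y0) = - 1], so the crude bound [1 + expR (- x)] is attained at [y0] and no later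
   point does better: a maximum over [[0, y0]] is global. *)
set y0 := pi / a.
have y00 : 0 < y0 by rewrite divr_gt0.
have [y] := EVT_max (ltW y00) (continuous_subspaceT ch).
rewrite in_itv/= => /andP[y1 y2] ymax.
have hy0 : gfun a y0 = 1 + expR (- y0).
  apply/eqP; rewrite -(eqrXn2 (n := 2))// ?gfun_ge0 ?addr_ge0 ?expR_ge0// gfun_sqr.
  by apply/eqP; rewrite /y0 mulrCA divff ?gt_eqF// mulr1 cospi; ring.
have gmax x : 0 <= x -> gfun a x <= gfun a y.
  move=> x0; have [xy|xy] := leP x y0.
    by rewrite -(ler_pXn2r (n := 2))// ?nnegrE ?gfun_ge0// -!hE ymax// in_itv/= x0.
  apply: le_trans (gfun_le _ x0) _.
  apply: (@le_trans _ _ (gfun a y0)).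
    by rewrite hy0 lerD2l ler_expR lerN2 ltW.
  by rewrite -(ler_pXn2r (n := 2))// ?nnegrE ?gfun_ge0// -!hE ymax// in_itv/= lexx ltW.
have gE : g a = gfun a y.
  apply/eqP; rewrite eq_le gfun_le_g// andbT.
  apply: ge_sup; first by exists (gfun a 0); exists 0 => //=.
  by move=> _ [x x0 <-]; exact: gmax.
have y_gt0 : 0 < y.
  rewrite lt_def y1 andbT; apply/eqP => y_0; have := g_gt0 a.
  have : gfun a y ^+ 2 = 0 by rewrite gfun_sqr y_0 oppr0 mulr0 cos0 expR0; ring.
  by move=> /eqP; rewrite sqrf_eq0 gE => /eqP ->; rewrite ltxx.
(* The right end is moved past [y0] so that the maximizer is interior even if it equals [y0]. *)
have yx0 : y <= y0 + 1 by lra.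
have d0 : 2 * expR (- y) * (cos (a * y) + a * sin (a * y)) - 2 * expR (- y) ^+ 2 = 0.
  have := @derive1_at_max R h 0 (y0 + 1) y.
  have -> : (0 <= y0 + 1 :> R) by lra.
  move=> /(_ isT) [].
  - by move=> x _; case: (is_derive_gfun_sqr a x).
  - by rewrite in_itv/= y_gt0/=; lra.
  - move=> x; rewrite in_itv/= => /andP[x0 _]; rewrite !hE.
    by rewrite ler_pXn2r// ?nnegrE ?gfun_ge0// gmax// ltW.
  - by move=> _ <-; apply/esym;
    rewrite (@derive_val _ _ _ _ _ _ _ (is_derive_gfun_sqr a y)).
have e0 := expR_gt0 (- y).
have cE : cos (a * y) + a * sin (a * y) = expR (- y).
  have nz : 2 * expR (- y) != 0 by rewrite gt_eqF// mulr_gt0.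
  by apply: (mulfI nz); move: d0; rewrite expr2; lra.
exists y; split => //.
have t0 : 0 < a * y by rewrite mulr_gt0.
have tpi : a * y <= pi by rewrite mulrC -ler_pdivlMr.
apply/andP; split; last first.
  rewrite lt_def tpi andbT; apply/eqP => pE.
  by move: cE; rewrite -pE cospi sinpi; lra.
rewrite ltNge; apply/negP => tle.
(* For [h = a * y] the critical equation turns the two sides of this strict inequality into the same
   number. *)
have := mul_expRN_lt y_gt0 (ltW t0) tle.
have -> : y * expR (- y) = y * cos (a * y) + a * y * sin (a * y) by rewrite -cE; ring.
by rewrite ltxx.
Qed.

End elementary.

(** * Integrals of complex-valued functions *)

Section complex_integrability.
Context d (T : measurableType d) (R : realType).
Variable mu : {measure set T -> \bar R}.
Implicit Types (D A B : set T) (f h : T -> R[i]) (c : R[i]).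

Lemma integrableZR D (u : T -> R) r : measurable D -> mu.-integrable D (EFin \o u) ->
  mu.-integrable D (EFin \o (fun x => r * u x)).
Proof. by move=> mD ui; apply: eq_integrable (integrableZl mD r ui). Qed.

Lemma integrableDR D (u v : T -> R) : measurable D -> mu.-integrable D (EFin \o u) ->
  mu.-integrable D (EFin \o v) -> mu.-integrable D (EFin \o (fun x => u x + v x)).
Proof. by move=> mD ui vi; apply: eq_integrable (integrableD mD ui vi). Qed.

Lemma cReD (z w : R[i]) : complex.Re (z + w) = complex.Re z + complex.Re w.
Proof. by case: z w => [? ?] []. Qed.

Lemma cImD (z w : R[i]) : complex.Im (z + w) = complex.Im z + complex.Im w.
Proof. by case: z w => [? ?] []. Qed.

Lemma cReM (z w : R[i]) : complex.Re (z * w) =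
  complex.Re z * complex.Re w - complex.Im z * complex.Im w.
Proof. by case: z w => [? ?] []. Qed.

Lemma cImM (z w : R[i]) : complex.Im (z * w) =
  complex.Re z * complex.Im w + complex.Im z * complex.Re w.
Proof. by case: z w => [? ?] []. Qed.

Lemma cReJ (z : R[i]) : complex.Re z^* = complex.Re z. Proof. by case: z. Qed.

Lemma cImJ (z : R[i]) : complex.Im z^* = - complex.Im z. Proof. by case: z. Qed.

Lemma complex_ext (z w : R[i]) : complex.Re z = complex.Re w ->
  complex.Im z = complex.Im w -> z = w.
Proof. by case: z w => [? ?] [? ?] /= -> ->. Qed.

Definition cmeasurable D f :=
  measurable_fun D (fun x => complex.Re (f x)) /\
  measurable_fun D (fun x => complex.Im (f x)).

Definition cintegrable D f :=
  mu.-integrable D (EFin \o (fun x => complex.Re (f x))) /\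
  mu.-integrable D (EFin \o (fun x => complex.Im (f x))).

Lemma cmeasurableS D A f : measurable D -> A `<=` D ->
  cmeasurable D f -> cmeasurable A f.
Proof. by move=> mD AD [? ?]; split; exact: measurable_funS mD AD _. Qed.

Lemma cmeasurableM D f h : cmeasurable D f -> cmeasurable D h ->
  cmeasurable D (fun x => f x * h x).
Proof.
move=> [f1 f2] [h1 h2]; split.
  apply: (eq_measurable_fun (fun x => complex.Re (f x) * complex.Re (h x) -
    complex.Im (f x) * complex.Im (h x))) => [x _|]; first by rewrite cReM.
  by apply: measurable_funB; exact: measurable_funM.
apply: (eq_measurable_fun (fun x => complex.Re (f x) * complex.Im (h x) +
  complex.Im (f x) * complex.Re (h x))) => [x _|]; first by rewrite cImM.
by apply: measurable_funD; exact: measurable_funM.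
Qed.

Lemma cmeasurable_cst D c : cmeasurable D (fun=> c).
Proof. by split; exact: measurable_cst. Qed.

Lemma cmeasurableJ D f : cmeasurable D f -> cmeasurable D (fun x => (f x)^*).
Proof.
move=> [f1 f2]; split.
  by apply: eq_measurable_fun f1 => x _; rewrite cReJ.
apply: (eq_measurable_fun (fun x => - complex.Im (f x))) => [x _|].
  by rewrite cImJ.
exact: measurableT_comp.
Qed.

Lemma measurable_cabs D f : cmeasurable D f -> measurable_fun D (fun x => cabs (f x)).
Proof.
move=> [f1 f2].
apply: (eq_measurable_fun (fun x =>
  Num.sqrt (complex.Re (f x) ^+ 2 + complex.Im (f x) ^+ 2))) => [x _|].
  by rewrite cabsE.
apply: (@measurableT_comp _ _ _ _ _ _ (@Num.sqrt R)).
  exact: (continuous_measurable_fun (@sqrt_continuous R)).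
by apply: measurable_funD; exact: measurable_funX.
Qed.

Lemma cintegrable_measurable D f : cintegrable D f -> cmeasurable D f.
Proof. by move=> [/measurable_int/measurable_EFinP ? /measurable_int/measurable_EFinP
  ?]. Qed.

Lemma cintegrableS D A f : measurable D -> measurable A -> A `<=` D ->
  cintegrable D f -> cintegrable A f.
Proof. by move=> mD mA AD [? ?]; split; exact: integrableS mD mA AD _. Qed.

Lemma eq_cintegrable D f h : measurable D -> {in D, f =1 h} ->
  cintegrable D f -> cintegrable D h.
Proof.
move=> mD fh [f1 f2]; split.
  by apply: eq_integrable f1 => // x xD /=; rewrite fh.
by apply: eq_integrable f2 => // x xD /=; rewrite fh.
Qed.

Lemma eq_cintegral D f h : {in D, f =1 h} -> cintegral mu D f = cintegral mu D h.
Proof.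
by move=> fh; rewrite /cintegral; congr (_ +i* _); apply: eq_Rintegral => x xD;
  rewrite fh.
Qed.

Lemma cintegrable_le D f (b : T -> R) : measurable D -> cmeasurable D f ->
  mu.-integrable D (EFin \o b) -> (forall x, D x -> cabs (f x) <= b x) ->
  cintegrable D f.
Proof.
move=> mD [f1 f2] bi fb; split.
  apply: le_integrable bi => //; first exact/measurable_EFinP.
  move=> x Dx /=; rewrite lee_fin (le_trans (Re_le_cabs _))// (le_trans (fb _ Dx))//.
  exact: ler_norm.
apply: le_integrable bi => //; first exact/measurable_EFinP.
move=> x Dx /=; rewrite lee_fin (le_trans (Im_le_cabs _))// (le_trans (fb _ Dx))//.
exact: ler_norm.
Qed.

Lemma integrable_cabs D f : measurable D -> cintegrable D f ->
  mu.-integrable D (EFin \o (fun x => cabs (f x))).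
Proof.
move=> mD fi; have [f1 f2] := fi.
have i1 := integrable_norm f1; have i2 := integrable_norm f2.
apply: le_integrable (integrableD mD i1 i2) => //.
  exact/measurable_EFinP/measurable_cabs/cintegrable_measurable.
move=> x Dx /=; rewrite lee_fin ger0_norm ?cabs_ge0//.
by apply: le_trans (cabs_le _) _; exact: ler_norm.
Qed.

Lemma cintegrableD D f h : measurable D -> cintegrable D f -> cintegrable D h ->
  cintegrable D (fun x => f x + h x).
Proof.
move=> mD [f1 f2] [h1 h2]; split.
  by apply: eq_integrable (integrableD mD f1 h1) => // x _ /=; rewrite cReD.
by apply: eq_integrable (integrableD mD f2 h2) => // x _ /=; rewrite cImD.
Qed.

Lemma cintegralD D f h : measurable D -> cintegrable D f -> cintegrable D h ->
  cintegral mu D (fun x => f x + h x) = cintegral mu D f + cintegral mu D h.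
Proof.
move=> mD [f1 f2] [h1 h2]; rewrite /cintegral; apply: complex_ext => /=.
  by rewrite -RintegralD//; apply: eq_Rintegral => x _; rewrite cReD.
by rewrite -RintegralD//; apply: eq_Rintegral => x _; rewrite cImD.
Qed.

Lemma cintegrableZ D c f : measurable D -> cintegrable D f ->
  cintegrable D (fun x => c * f x).
Proof.
move=> mD [f1 f2]; split.
  apply: eq_integrable (integrableB mD (integrableZl mD (complex.Re c) f1)
    (integrableZl mD (complex.Im c) f2)) => // x _ /=; by rewrite cReM.
apply: eq_integrable (integrableD mD (integrableZl mD (complex.Re c) f2)
  (integrableZl mD (complex.Im c) f1)) => // x _ /=; by rewrite cImM.
Qed.

Lemma cintegralZ D c f : measurable D -> cintegrable D f ->
  cintegral mu D (fun x => c * f x) = c * cintegral mu D f.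
Proof.
move=> mD [f1 f2]; rewrite /cintegral; apply: complex_ext; rewrite ?cReM ?cImM /=.
  rewrite -!RintegralZl// -RintegralB//; try exact: integrableZR.
  by apply: eq_Rintegral => x _; rewrite cReM.
rewrite -!RintegralZl// -RintegralD//; try exact: integrableZR.
by apply: eq_Rintegral => x _; rewrite cImM.
Qed.

Lemma cintegrableB D f h : measurable D -> cintegrable D f -> cintegrable D h ->
  cintegrable D (fun x => f x - h x).
Proof.
move=> mD fi hi; have := cintegrableD mD fi (cintegrableZ (-1) mD hi).
by apply: eq_cintegrable => // x _; rewrite mulN1r.
Qed.

Lemma cintegralB D f h : measurable D -> cintegrable D f -> cintegrable D h ->
  cintegral mu D (fun x => f x - h x) = cintegral mu D f - cintegral mu D h.
Proof.
move=> mD fi hi; rewrite -mulN1r -cintegralZ// -cintegralD//; last exact: cintegrableZ.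
by apply: eq_cintegral => x _; rewrite mulN1r.
Qed.

Lemma cintegrableJ D f : measurable D -> cintegrable D f ->
  cintegrable D (fun x => (f x)^*).
Proof.
move=> mD [f1 f2]; split.
  by apply: eq_integrable f1 => // x _ /=; rewrite cReJ.
by apply: eq_integrable (integrableN f2) => // x _ /=; rewrite cImJ.
Qed.

Lemma cintegralJ D f : measurable D -> cintegrable D f ->
  cintegral mu D (fun x => (f x)^*) = (cintegral mu D f)^*.
Proof.
move=> mD [f1 f2]; apply: complex_ext => /=.
  by apply: eq_Rintegral => x _; rewrite cReJ.
rewrite -mulN1r -RintegralZl//.
by apply: eq_Rintegral => x _; rewrite cImJ mulN1r.
Qed.

Lemma cintegral0 D : cintegral mu D (fun=> 0) = 0.
Proof. by apply: complex_ext => /=; rewrite /Rintegral integral0. Qed.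

Lemma cintegral_setU A B f : measurable A -> measurable B ->
  cintegrable (A `|` B) f -> [disjoint A & B] ->
  cintegral mu (A `|` B) f = cintegral mu A f + cintegral mu B f.
Proof.
move=> mA mB [f1 f2] AB; apply: complex_ext; rewrite ?cReD ?cImD /=.
  by rewrite Rintegral_setU.
by rewrite Rintegral_setU.
Qed.

(* Rotating the integral onto the positive real axis reduces to the real case. *)
Lemma le_cabs_cintegral D f : measurable D -> cintegrable D f ->
  cabs (cintegral mu D f) <= \int[mu]_(x in D) cabs (f x).
Proof.
move=> mD fi; set I := cintegral mu D f.
have [->|I0] := eqVneq I 0.
  rewrite (_ : cabs 0 = 0); last by apply/eqP; rewrite cabs_eq0.
  by apply: Rintegral_ge0 => x _; exact: cabs_ge0.
have cI : cabs I != 0 by rewrite cabs_eq0.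
set u := I^* / (cabs I)%:C.
have cu : cabs u = 1.
  by rewrite cabsM cabsV cabsJ cabsR ger0_norm ?cabs_ge0// divff.
have -> : cabs I = complex.Re (u * I).
  rewrite /u mulrAC (_ : I^* * I = (cabs I ^+ 2)%:C); last first.
    by apply: complex_ext; rewrite ?cReM ?cImM cabs_sqr; case: (I) => a b /=; ring.
  have -> : (cabs I ^+ 2)%:C / (cabs I)%:C = (cabs I)%:C.
    by rewrite -fmorph_div/= expr2 mulfK.
  by [].
rewrite -cintegralZ//= /cintegral/=.
have ui := cintegrableZ u mD fi.
apply: le_Rintegral => //; first by case: ui.
  exact: integrable_cabs.
move=> x _; apply: le_trans (ler_norm _) _; apply: le_trans (Re_le_cabs _) _.
by rewrite cabsM cu mul1r.
Qed.

Lemma cintegral_bound D f (M : R) : measurable D -> cintegrable D f ->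
  (mu D < +oo)%E -> (forall x, D x -> cabs (f x) <= M) ->
  cabs (cintegral mu D f) <= M * fine (mu D).
Proof.
move=> mD fi Dfin fM; apply: le_trans (le_cabs_cintegral mD fi) _.
rewrite -Rintegral_cst//; apply: le_Rintegral => //; first exact: integrable_cabs.
apply/integrableP; split; first exact/measurable_EFinP/measurable_cst.
under eq_integral do rewrite /=.
by rewrite integral_cst// lte_mul_pinfty// lee_fin.
Qed.

Lemma cintegrableM_bound D f h (K : R) : measurable D -> cintegrable D f ->
  cmeasurable D h -> (forall x, D x -> cabs (h x) <= K) ->
  cintegrable D (fun x => f x * h x).
Proof.
move=> mD fi mh hK.
apply: (@cintegrable_le _ _ (fun x => K * cabs (f x))) => //.
- by apply: cmeasurableM => //; exact: cintegrable_measurable.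
- exact/integrableZR/integrable_cabs.
- by move=> x Dx; rewrite cabsM mulrC ler_wpM2r ?cabs_ge0// hK.
Qed.

End complex_integrability.

(** * Primitives and integration by parts *)

Section real_line.
Context {R : realType}.
Local Notation mu := (@lebesgue_measure R).
Local Notation cmeas := (@cmeasurable _ (measurableTypeR R) R).
Implicit Types (p q s t x y : R) (f u v : R -> R[i]).

(** On [n] equal pieces of [[p, q]] the factor [t - s] is [(q - p) / n] while the increments of [M]
    telescope, so [cabs (h q - h p)] is at most a constant over [n]. With [M] a variation, only an
    integrable derivative has to be available. *)
Lemma eq_of_square_increments (h : R -> R[i]) (M : R -> R) (C p q : R) : p <= q ->
  (forall s t, p <= s -> s <= t -> t <= q ->
     cabs (h t - h s) <= C * (t - s) * (M t - M s)) ->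
  h q = h p.
Proof.
move=> pq hM; apply/eqP; rewrite -subr_eq0 -cabs_eq0 eq_le cabs_ge0 andbT.
set X := cabs _; rewrite leNgt; apply/negP => X0.
have step n : X * n.+1%:R <= C * (q - p) * (M q - M p).
  set e := (q - p) / n.+1%:R.
  have e0 : 0 <= e by rewrite divr_ge0 ?subr_ge0.
  have en : e * n.+1%:R = q - p by rewrite /e divfK.
  have ind k : (k <= n.+1)%N ->
      cabs (h (p + e * k%:R) - h p) <= C * e * (M (p + e * k%:R) - M p).
    elim: k => [_|k ih kn].
      by rewrite mulr0 addr0 !subrr mulr0 le_eqVlt cabs_eq0 eqxx.
    have -> : h (p + e * k.+1%:R) - h p =
      (h (p + e * k.+1%:R) - h (p + e * k%:R)) + (h (p + e * k%:R) - h p) by ring.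
    have pk : p <= p + e * k%:R by rewrite lerDl mulr_ge0.
    have kk : p + e * k%:R <= p + e * k.+1%:R by rewrite lerD2l ler_wpM2l// ler_nat.
    have kq : p + e * k.+1%:R <= q.
      by rewrite -lerBrDl -en ler_wpM2l// ler_nat.
    apply: le_trans (cabsD _ _) _.
    have := hM _ _ pk kk kq; have := ih (ltnW kn).
    have -> : p + e * k.+1%:R - (p + e * k%:R) = e by rewrite -natr1; ring.
    by lra.
  have := ind _ (leqnn _); rewrite en (_ : p + (q - p) = q); last by ring.
  rewrite -/X -(@ler_pM2r _ n.+1%:R)// => /le_trans; apply.
  by rewrite -en le_eqVlt (_ : _ == _)//; apply/eqP; ring.
have := step (Num.bound `|C * (q - p) * (M q - M p) / X|).
apply/negP; rewrite -ltNge -ltr_pdivrMl// mulrC.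
apply: le_lt_trans (ler_norm _) _.
by apply: lt_trans (archi_boundP (normr_ge0 _)) _; rewrite ltr_nat.
Qed.

Lemma mitv (i : interval R) : measurable ([set` i] : set (measurableTypeR R)).
Proof. exact: measurable_itv. Qed.

Lemma itv_ocU p s t : p <= s -> s <= t -> `]p, t]%classic = `]p, s] `|` `]s, t].
Proof.
move=> ps st; apply/seteqP; split => x /=; rewrite !in_itv/=.
  move=> /andP[px xt]; have [xs|sx] := leP x s; first by left; rewrite px.
  by right.
by move=> [/andP[-> xs]|/andP[sx ->]]; rewrite ?andbT ?(le_trans xs)// (le_lt_trans ps).
Qed.

Lemma disjoint_ocU p s t : [disjoint `]p, s]%classic & `]s, t]%classic].
Proof.
apply/disj_setPS => x /=; rewrite !in_itv/= => -[/andP[_ xs] /andP[sx _]].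
by move: (le_lt_trans xs sx); rewrite ltxx.
Qed.

Lemma cintegral_ocU p s t f : p <= s -> s <= t -> cintegrable mu `]p, t] f ->
  cintegral mu `]p, t] f = cintegral mu `]p, s] f + cintegral mu `]s, t] f.
Proof.
move=> ps st fi; rewrite (itv_ocU ps st) cintegral_setU//; first by rewrite -itv_ocU.
exact: disjoint_ocU.
Qed.

Lemma Rintegral_ocU p s t (f : R -> R) : p <= s -> s <= t ->
  mu.-integrable `]p, t] (EFin \o f) ->
  \int[mu]_(x in `]p, t]) f x = \int[mu]_(x in `]p, s]) f x + \int[mu]_(x in `]s,
    t]) f x.
Proof.
move=> ps st fi; rewrite (itv_ocU ps st) Rintegral_setU//; first by rewrite -itv_ocU.
exact: disjoint_ocU.
Qed.

Lemma subset_oc p q s t : p <= s -> t <= q -> `]s, t]%classic `<=` `]p, q]%classic.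
Proof.
move=> ps tq x /=; rewrite !in_itv/= => /andP[sx xt].
by rewrite (le_lt_trans ps)//= (le_trans xt).
Qed.

Lemma fine_lebesgue_oc s t : s <= t -> fine (mu `]s, t]) = t - s.
Proof.
move=> st; rewrite lebesgue_measure_itv/= lte_fin; case: ltP => [_|ts]; first
  by rewrite -EFinB.
by apply/esym/eqP; rewrite subr_eq0 eq_le ts.
Qed.

Lemma lebesgue_oc_lty s t : (mu `]s, t] < +oo)%E.
Proof.
by rewrite lebesgue_measure_itv/=; case: ifP => _; rewrite ?ltry// -EFinB ltry.
Qed.

(** Absolute continuity on [[p, q]] with almost everywhere derivative [f'], in integrated form so
    that no pointwise derivative is mentioned. *)
Definition primitive_on p q f (f' : R -> R[i]) :=
  cintegrable mu `]p, q] f' /\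
  forall x y, p <= x -> x <= y -> y <= q -> f y - f x = cintegral mu `]x, y] f'.

Lemma primitive_onS p q s t f f' : p <= s -> t <= q ->
  primitive_on p q f f' -> primitive_on s t f f'.
Proof.
move=> ps tq [fi fE]; split.
  by apply: cintegrableS fi => //; exact: subset_oc.
by move=> x y sx xy yt; apply: fE => //; [exact: le_trans sx|exact: le_trans tq].
Qed.

Lemma primitive_on_le p q f f' s x t : primitive_on p q f f' ->
  p <= s -> s <= x -> x <= t -> t <= q ->
  cabs (f x - f s) <= \int[mu]_(y in `]s, t]) cabs (f' y).
Proof.
move=> [fi fE] ps sx xt tq; rewrite fE//; last exact: le_trans tq.
have mst : cintegrable mu `]s, t] f'.
  by apply: cintegrableS fi => //; exact: subset_oc.
apply: le_trans (le_cabs_cintegral _ _) _ => //.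
  by apply: cintegrableS mst => //; exact: subset_oc.
rewrite (Rintegral_ocU sx xt) ?lerDl ?Rintegral_ge0//; first
  by move=> *; exact: cabs_ge0.
exact: integrable_cabs.
Qed.

Lemma primitive_on_bound p q f f' x : primitive_on p q f f' -> p <= x -> x <= q ->
  cabs (f x) <= cabs (f p) + \int[mu]_(y in `]p, q]) cabs (f' y).
Proof.
move=> fp px xq; rewrite -[f x](subrK (f p)) addrC.
by apply: le_trans (cabsD _ _) _; rewrite lerD2l (primitive_on_le fp).
Qed.

(* Splitting [p, q] into n equal pieces, the defect of the product rule is
   O(1/n) times the total variation of u. *)
Lemma primitive_on_by_parts p q u u' v v' (K : R) : p <= q ->
  primitive_on p q u u' -> cmeas `]p, q] u ->
  primitive_on p q v v' -> cmeas `]p, q] v ->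
  (forall x, p <= x <= q -> cabs (v' x) <= K) ->
  cintegrable mu `]p, q] (fun x => u' x * v x + u x * v' x) /\
  cintegral mu `]p, q] (fun x => u' x * v x + u x * v' x) = u q * v q - u p * v p.
Proof.
move=> pq up mu_ vp mv v'K.
have [u'i uE] := up; have [v'i vE] := vp.
have bdd s t x : `]s, t]%classic x -> s <= x <= t.
  by rewrite /= in_itv/= => /andP[/ltW -> ->].
have i1 : cintegrable mu `]p, q] (fun x => u' x * v x).
  apply: cintegrableM_bound => // x /bdd/andP[px xq].
  exact: primitive_on_bound vp px xq.
have i2 : cintegrable mu `]p, q] (fun x => u x * v' x).
  apply: eq_cintegrable (_ : cintegrable mu `]p, q] (fun x => v' x * u x)) => //.
    by move=> x _; rewrite mulrC.
  apply: cintegrableM_bound => // x /bdd/andP[px xq].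
  exact: primitive_on_bound up px xq.
have i12 := cintegrableD (mitv _) i1 i2.
split => //.
(* Up to the constant [u p * v p], the defect of the product rule on [[p, t]]; [M] is the variation
   of [u]. *)
pose h t := cintegral mu `]p, t] (fun x => u' x * v x + u x * v' x) - u t * v t.
pose M t := \int[mu]_(x in `]p, t]) cabs (u' x).
suff : h q = h p.
  have -> : h p = - (u p * v p).
    rewrite /h (_ : `]p, p]%classic = set0); last by rewrite set_itv_ge// bnd_simp ltxx.
    rewrite [cintegral _ _ _](_ : _ = 0) ?sub0r//.
    by apply: complex_ext; rewrite /= Rintegral_set0.
  by rewrite /h => /eqP; rewrite subr_eq => /eqP ->; ring.
apply: (@eq_of_square_increments h M (2 * K) _ _ pq) => s t ps st tq.
have pt := le_trans ps st; have sq := le_trans st tq.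
have sub : `]s, t]%classic `<=` `]p, q]%classic by exact: subset_oc.
have sti w : cintegrable mu `]p, q] w -> cintegrable mu `]s, t] w.
  by move=> wi; apply: cintegrableS wi.
have cst c : cintegrable mu `]s, t] (fun=> c).
  split; apply/integrableP; split; try exact/measurable_EFinP/measurable_cst;
  by under eq_integral do rewrite /=;
    rewrite integral_cst// lte_mul_pinfty ?lee_fin// lebesgue_oc_lty.
have j1 : cintegrable mu `]s, t] (fun x => v t * u' x)
  by apply: cintegrableZ => //; exact: sti.
have j2 : cintegrable mu `]s, t] (fun x => u s * v' x)
  by apply: cintegrableZ => //; exact: sti.
(* Taking [v] at the right end and [u] at the left end splits [u t * v t - u s * v s] exactly, so
   each remaining term is a derivative times an increment. *)
have hE : h t - h s = cintegral mu `]s, t]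
    (fun x => u' x * (v x - v t) + (u x - u s) * v' x).
  rewrite /h (cintegral_ocU ps st); last by apply: cintegrableS i12 => //;
    exact: subset_oc.
  have -> : cintegral mu `]s, t] (fun x => u' x * (v x - v t) + (u x - u s) * v' x) =
      cintegral mu `]s, t] (fun x =>
        (u' x * v x + u x * v' x) - (v t * u' x + u s * v' x)).
    by apply: eq_cintegral => x _; ring.
  rewrite cintegralB//; [|exact: sti|exact: cintegrableD].
  rewrite (cintegralD _ j1 j2)// !cintegralZ//; [|exact: sti|exact: sti].
  by rewrite -uE// -vE//; ring.
have di : cintegrable mu `]s, t] (fun x => u' x * (v x - v t) + (u x - u s) * v' x).
  apply: eq_cintegrable (cintegrableB _ (sti _ i12) (cintegrableD _ j1 j2)) => // x _.
  by ring.
rewrite hE; apply: le_trans (le_cabs_cintegral _ di) _ => //.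
set J := M t - M s.
have JE : J = \int[mu]_(x in `]s, t]) cabs (u' x).
  rewrite /J /M (Rintegral_ocU ps st); first by rewrite addrAC subrr add0r.
  by apply: integrable_cabs => //; apply: cintegrableS u'i => //; exact: subset_oc.
have K0 : 0 <= K by apply: le_trans (v'K p _); rewrite ?cabs_ge0// lexx.
have vL x : s <= x -> x <= t -> cabs (v x - v t) <= K * (t - s).
  move=> sx xt; rewrite -cabsN opprB vE//; last exact: le_trans ps sx.
  apply: le_trans (cintegral_bound (M := K) _ _ _ _) _ => //.
  - by apply: cintegrableS v'i => //; apply: subset_oc => //; exact: le_trans ps sx.
  - exact: lebesgue_oc_lty.
  - move=> y /bdd/andP[xy yt]; apply: v'K; rewrite (le_trans _ xy) ?(le_trans ps)//=.
    exact: le_trans tq.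
  - by rewrite fine_lebesgue_oc// ler_wpM2l// lerD2l lerN2.
have ui : mu.-integrable `]s, t] (EFin \o (fun x => cabs (u' x))).
  by apply: integrable_cabs => //; exact: sti.
apply: (@le_trans _ _ (\int[mu]_(x in `]s, t]) (K * (t - s) * cabs (u' x) + J * K))).
  have ci : mu.-integrable `]s, t] (EFin \o (fun=> J * K)) by have [] := cst (J * K)%:C.
  apply: le_Rintegral => //; first exact: integrable_cabs.
    by apply: eq_integrable (integrableD _ (integrableZR (K * (t - s)) _ ui) ci).
  move=> x xst; have /andP[sx xt] := bdd _ _ _ xst.
  apply: le_trans (cabsD _ _) _; rewrite !cabsM lerD//.
    by rewrite mulrC ler_wpM2r ?cabs_ge0// vL.
  apply: ler_pM; rewrite ?cabs_ge0//; first by rewrite JE (primitive_on_le up).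
  by apply: v'K; rewrite (le_trans ps)//= (le_trans xt).
have ci : mu.-integrable `]s, t] (EFin \o (fun=> J * K)) by have [] := cst (J * K)%:C.
rewrite RintegralD//; last exact: integrableZR.
rewrite RintegralZl// -JE Rintegral_cst// fine_lebesgue_oc//.
by rewrite le_eqVlt (_ : _ == _)//; apply/eqP; ring.
Qed.

End real_line.

(** * Half-lines: tails, limits and square integrability *)

Section tails.
Context {R : realType}.
Local Notation mu := (@lebesgue_measure R).
Local Notation cmeas := (@cmeasurable _ (measurableTypeR R) R).
Implicit Types (p q s t x y : R) (f u v : R -> R[i]).

Lemma subset_le_Rintegral (A B : set (measurableTypeR R)) (f : R -> R) :
  measurable A -> measurable B -> A `<=` B -> (forall x, 0 <= f x) ->
  mu.-integrable B (EFin \o f) ->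
  \int[mu]_(x in A) f x <= \int[mu]_(x in B) f x.
Proof.
move=> mA mB AB f0 fB; have fA : mu.-integrable A (EFin \o f) by exact: integrableS fB.
apply: fine_le; [exact: integrable_fin_num|exact: integrable_fin_num|].
apply: ge0_subset_integral => //; first by have /measurable_int := fB.
by move=> x _; rewrite lee_fin.
Qed.

Lemma subset_oy p q : p <= q -> `]q, +oo[%classic `<=` `]p, +oo[%classic.
Proof.
by move=> pq x /=; rewrite !in_itv/= !andbT; exact: le_lt_trans.
Qed.


(** Dominated convergence for the truncations of [f] to []n, +oo[], each point being dropped
    eventually. *)
Lemma integral_tail_small (f : R -> R) p (e : R) : 0 < e -> (forall x, 0 <= f x) ->
  mu.-integrable `]p, +oo[ (EFin \o f) ->
  exists N : R, forall q, p <= q -> N <= q -> \int[mu]_(x in `]q, +oo[) f x <= e.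
Proof.
move=> e0 f0 fi.
pose f_ (n : nat) (x : measurableTypeR R) := ((f \_ `]n%:R, +oo[) x)%:E.
have mf n : measurable_fun (`]p, +oo[%classic : set (measurableTypeR R)) (f_ n).
  rewrite /f_; apply/measurable_EFinP.
  apply/(@measurable_restrict _ _ (measurableTypeR R)); [exact: mitv..|].
  apply: (@measurable_funS _ _ (measurableTypeR R) _ `]p, +oo[); [exact: mitv| |].
    by move=> x [].
  by have /measurable_int/measurable_EFinP := fi.
have cf (x : measurableTypeR R) : `]p, +oo[%classic x ->
  f_ n x @[n --> \oo] --> (0%:E : \bar R).
  move=> _; apply: cvg_near_cst.
  near=> n; rewrite /f_ patchE ifF//; apply/negbTE; rewrite notin_setE/= in_itv/= andbT.
  apply/negP; rewrite -leNgt; near: n; exact: nbhs_infty_ger.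
have := @dominated_cvg _ _ _ mu `]p,
  +oo[%classic (mitv _) f_ (fun=> 0%:E) (EFin \o f) mf cf (fun _ _ => isT) fi.
have fle n x : `]p, +oo[%classic x -> (`|f_ n x| <= (EFin \o f) x)%E.
  move=> _; rewrite /f_ patchE; case: ifP => _ /=; rewrite lee_fin ger0_norm//.
move=> /(_ fle); rewrite integral0 =>
  /fine_cvg/cvgrPdist_le/(_ _ e0)[N _] /(_ N (leqnn _)).
rewrite sub0r normrN => /= H.
exists N%:R => q pq Nq.
apply: le_trans (le_trans (ler_norm _) H).
have -> : fine (\int[mu]_(x in `]p, +oo[) f_ N x)%E = \int[mu]_(x in `]p,
  +oo[ `&` `]N%:R, +oo[) f x.
  by rewrite Rintegral_mkcondr.
apply: subset_le_Rintegral => //.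
- by apply: measurableI => //; exact: mitv.
- by move=> x xq; split; exact: subset_oy xq.
- by apply: integrableS fi => //; apply: measurableI => //; exact: mitv.
Unshelve. all: by end_near. Qed.

Lemma itv_oyU p q : p <= q -> `]p, +oo[%classic = `]p, q] `|` `]q, +oo[.
Proof.
move=> pq; apply/seteqP; split => x /=; rewrite !in_itv/= !andbT.
  by move=> px; have [xq|qx] := leP x q; [left; rewrite px|right].
by move=> [/andP[]//|]; exact: le_lt_trans.
Qed.

Lemma disjoint_oyU p q : [disjoint `]p, q]%classic & `]q, +oo[%classic].
Proof.
apply/disj_setPS => x /=; rewrite !in_itv/= andbT => -[/andP[_ xq] qx].
by move: (le_lt_trans xq qx); rewrite ltxx.
Qed.

Lemma cintegral_oyU p q f : p <= q -> cintegrable mu `]p, +oo[ f ->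
  cintegral mu `]p, +oo[ f = cintegral mu `]p, q] f + cintegral mu `]q, +oo[ f.
Proof.
move=> pq fi; rewrite (itv_oyU pq) cintegral_setU//; first by rewrite -itv_oyU.
exact: disjoint_oyU.
Qed.

(** Integrability makes the tails vanish, so the full integral is the limit of the partial ones.
    This passes from boundary terms at [q] to boundary terms at infinity. *)
Lemma cintegral_oy_lim p f (B : R -> R[i]) (L : R[i]) : cintegrable mu `]p, +oo[ f ->
  (forall q, p <= q -> cintegral mu `]p, q] f = B q) ->
  (forall e : R, 0 < e -> exists N : R, forall q, N <= q -> cabs (B q - L) <= e) ->
  cintegral mu `]p, +oo[ f = L.
Proof.
move=> fi fB BL; apply/eqP; rewrite -subr_eq0 -cabs_eq0 eq_le cabs_ge0 andbT.
apply/ler_addgt0Pr => e e0; rewrite add0r.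
have e20 : 0 < e / 2 by rewrite divr_gt0.
have [N1 HN1] := BL _ e20.
have fi' := integrable_cabs (mitv _) fi.
have [N2 HN2] := integral_tail_small e20 (fun x => cabs_ge0 (f x)) fi'.
set q := Num.max p (Num.max N1 N2).
have pq : p <= q by rewrite le_max lexx.
have N1q : N1 <= q by rewrite !le_max lexx orbT.
have N2q : N2 <= q by rewrite !le_max lexx !orbT.
rewrite (cintegral_oyU pq fi) fB//.
have -> : B q + cintegral mu `]q, +oo[ f - L = (B q - L) + cintegral mu `]q,
  +oo[ f by ring.
apply: le_trans (cabsD _ _) _; rewrite [leRHS]splitr lerD ?HN1//.
apply: le_trans (HN2 _ pq N2q); apply: le_cabs_cintegral => //.
by apply: cintegrableS fi => //; exact: subset_oy.
Qed.

(** [square_integrable] on an arbitrary set, because test functions are assembled from pieces. *)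
Definition sqint (A : set (measurableTypeR R)) f :=
  cmeas A f /\ mu.-integrable A (EFin \o (fun x => cabs (f x) ^+ 2)).

Lemma square_integrableP f : square_integrable f <-> sqint (halfline R) f.
Proof. by split => [[? ? ?]|[[? ?] ?]]. Qed.

Lemma sqintS A B f : measurable A -> measurable B -> A `<=` B -> sqint B f -> sqint A f.
Proof.
move=> mA mB AB [f1 f2]; split; first exact: cmeasurableS f1.
exact: integrableS f2.
Qed.

Lemma eq_sqint A f h : measurable A -> {in A, f =1 h} -> sqint A f -> sqint A h.
Proof.
move=> mA fh [[f1 f2] f3]; split; first split.
- by apply: eq_measurable_fun f1 => x xA; rewrite fh.
- by apply: eq_measurable_fun f2 => x xA; rewrite fh.
- by apply: eq_integrable f3 => // x xA /=; rewrite fh.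
Qed.

Lemma integrable_setU (A B : set (measurableTypeR R)) (f : R -> \bar R) :
  measurable A -> measurable B -> [disjoint A & B] ->
  mu.-integrable A f -> mu.-integrable B f -> mu.-integrable (A `|` B) f.
Proof.
move=> mA mB AB /integrableP[fA iA] /integrableP[fB iB].
have mAB : measurable_fun (A `|` B) f by apply/measurable_funU.
apply/integrableP; split => //.
rewrite ge0_integral_setU//; last exact: measurableT_comp.
by rewrite lte_add_pinfty.
Qed.

Lemma sqint_setU (A B : set (measurableTypeR R)) f :
  measurable A -> measurable B -> [disjoint A & B] ->
  sqint A f -> sqint B f -> sqint (A `|` B) f.
Proof.
move=> mA mB AB [[a1 a2] a3] [[b1 b2] b3]; split; last exact: integrable_setU.
by split; apply/measurable_funU.
Qed.

Lemma sqintM A f h : measurable A -> sqint A f -> sqint A h ->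
  cintegrable mu A (fun x => f x * h x).
Proof.
move=> mA [mf f2] [mh h2].
apply: cintegrable_le (integrableD mA f2 h2) _ => //; first exact: cmeasurableM.
move=> x _ /=; rewrite cabsM.
have := sqr_ge0 (cabs (f x) - cabs (h x)); have := sqr_ge0 (cabs (f x) + cabs (h x)).
by rewrite sqrrB sqrrD; lra.
Qed.

Lemma sqintJ A f : sqint A f -> sqint A (fun x => (f x)^*).
Proof.
move=> [mf f2]; split; first exact: cmeasurableJ.
by under [X in integrable _ _ X]eq_fun do rewrite /= cabsJ.
Qed.

Lemma sqint0 A : sqint A (fun=> 0).
Proof.
split; first exact: cmeasurable_cst.
rewrite (_ : EFin \o _ = cst 0%E); first exact: integrable0.
by apply/funext => x; congr (_%:E); apply/eqP; rewrite sqrf_eq0 cabs_eq0.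
Qed.

Lemma sqintZ A c f : measurable A -> sqint A f -> sqint A (fun x => c * f x).
Proof.
move=> mA [mf f2]; split; first by apply: cmeasurableM => //; exact: cmeasurable_cst.
have := integrableZR (cabs c ^+ 2) mA f2.
by under [X in integrable _ _ X -> _]eq_fun do rewrite /= -exprMn -cabsM.
Qed.

Lemma sqint_bounded s t f (K : R) : cmeas `]s, t] f ->
  (forall x, s <= x <= t -> cabs (f x) <= K) -> sqint `]s, t] f.
Proof.
move=> mf fK; split => //.
apply: measurable_bounded_integrable => //; first exact: lebesgue_oc_lty.
  by apply: measurable_funX; exact: measurable_cabs.
exists (K ^+ 2); split; first exact: num_real.
move=> M KM x /=; rewrite in_itv/= => /andP[sx xt].
rewrite ger0_norm ?sqr_ge0// (le_trans _ (ltW KM))//.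
by rewrite lerXn2r ?nnegrE ?cabs_ge0 ?fK ?(ltW sx)// (le_trans (cabs_ge0 _) (fK x
  _))// (ltW sx).
Qed.

End tails.

(** * Free solutions and the complex exponential *)

Section smooth.
Context {R : realType}.
Local Notation mu := (@lebesgue_measure R).
Local Notation cmeas := (@cmeasurable _ (measurableTypeR R) R).
Implicit Types (p q s t x y : R) (f u v : R -> R[i]) (c z lam : R[i]).

Definition cderive f f' :=
  (forall x, is_derive x 1 (fun y => complex.Re (f y)) (complex.Re (f' x))) /\
  (forall x, is_derive x 1 (fun y => complex.Im (f y)) (complex.Im (f' x))).

Definition ccontinuous f :=
  continuous (fun y => complex.Re (f y) : R) /\ continuous (fun y =>
    complex.Im (f y) : R).

Lemma is_derive_continuous (F : R -> R) (f : R -> R) :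
  (forall x, is_derive x 1 F (f x)) -> continuous F.
Proof.
move=> Ff x; apply: differentiable_continuous; apply/derivable1_diffP.
by case: (Ff x).
Qed.

Lemma cderive_continuous f f' : cderive f f' -> ccontinuous f.
Proof. by move=> [f1 f2]; split;
  [exact: is_derive_continuous f1|exact: is_derive_continuous f2]. Qed.

Lemma ccontinuous_cmeas (A : set (measurableTypeR R)) f : ccontinuous f -> cmeas A f.
Proof.
move=> [f1 f2]; split.
  by apply: measurable_funTS; exact: continuous_measurable_fun.
by apply: measurable_funTS; exact: continuous_measurable_fun.
Qed.

Lemma ccontinuous_bounded f p q : p <= q -> ccontinuous f ->
  exists K : R, forall x, p <= x <= q -> cabs (f x) <= K.
Proof.
move=> pq [f1 f2].
have c1 : {within `[p, q], continuous (fun y =>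
  `|complex.Re (f y)| + `|complex.Im (f y)|)}.
  apply: continuous_subspaceT => x.
  by apply: cvgD; apply: cvg_norm; [exact: f1|exact: f2].
have [c _ cm] := EVT_max pq c1.
exists (`|complex.Re (f c)| + `|complex.Im (f c)|) => x xpq.
by apply: le_trans (cabs_le _) _; apply: cm; rewrite in_itv.
Qed.

Lemma integral_derive (F f : R -> R) x y : (forall x, is_derive x 1 F (f x)) ->
  continuous f -> x <= y ->
  mu.-integrable `]x, y] (EFin \o f) /\ \int[mu]_(t in `]x, y]) f t = F y - F x.
Proof.
move=> Ff fc xy; have Fc := is_derive_continuous Ff.
have ic : mu.-integrable `[x, y] (EFin \o f).
  apply: continuous_compact_integrable; first exact: segment_compact.
  exact: continuous_subspaceT.
have io : mu.-integrable `]x, y] (EFin \o f).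
  by apply: integrableS ic => //; exact: subset_itv_oc_cc.
split => //; rewrite Rintegral_itv_obnd_cbnd//.
move: xy; rewrite le_eqVlt => /predU1P[->|xy].
  by rewrite set_itv1 Rintegral_set1 subrr.
rewrite /Rintegral (@continuous_FTC2 _ f F)//.
- exact: continuous_subspaceT.
- split; first by move=> z _; case: (Ff z).
    by apply: cvg_at_right_filter; exact: Fc.
  by apply: cvg_at_left_filter; exact: Fc.
- by move=> z _; rewrite derive1E; case: (Ff z).
Qed.

Lemma cderive_primitive f f' p q : cderive f f' -> ccontinuous f' -> p <= q ->
  primitive_on p q f f'.
Proof.
move=> [f1 f2] [c1 c2] pq; split.
  by split; [have [] := integral_derive f1 c1 pq|have [] := integral_derive f2 c2 pq].
move=> x y px xy yq; apply: complex_ext => /=.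
  by have [_ ->] := integral_derive f1 c1 xy; rewrite cReD; case: (f x).
by have [_ ->] := integral_derive f2 c2 xy; rewrite cImD; case: (f x).
Qed.

Lemma cderiveZ c f f' : cderive f f' -> cderive (fun x => c * f x) (fun x => c * f' x).
Proof.
move=> [f1 f2]; split => x.
  rewrite (_ : (fun y => _) = (fun y =>
    complex.Re c * complex.Re (f y) - complex.Im c * complex.Im (f y))).
    by apply: is_derive_eq; rewrite cReM /GRing.scale/=; ring.
  by apply/funext => y; rewrite cReM.
rewrite (_ : (fun y => _) = (fun y =>
  complex.Re c * complex.Im (f y) + complex.Im c * complex.Re (f y))).
  by apply: is_derive_eq; rewrite cImM /GRing.scale/=; ring.
by apply/funext => y; rewrite cImM.
Qed.

Lemma cderiveD f f' h h' : cderive f f' -> cderive h h' ->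
  cderive (fun x => f x + h x) (fun x => f' x + h' x).
Proof.
move=> [f1 f2] [h1 h2]; split => x.
  rewrite (_ : (fun y => _) = (fun y => complex.Re (f y) + complex.Re (h y))).
    by apply: is_derive_eq; rewrite cReD.
  by apply/funext => y; rewrite cReD.
rewrite (_ : (fun y => _) = (fun y => complex.Im (f y) + complex.Im (h y))).
  by apply: is_derive_eq; rewrite cImD.
by apply/funext => y; rewrite cImD.
Qed.

Lemma eq_cderive f h f' h' : f =1 h -> f' =1 h' -> cderive f f' -> cderive h h'.
Proof. by move=> /funext -> /funext ->. Qed.

(** Smooth solutions of [- v'' = lam v] on the whole line, with the derivative carried along. *)
Definition free_solution (lam : R[i]) v v' :=
  cderive v v' /\ cderive v' (fun x => - lam * v x).

Lemma free_solutionZ lam c v v' : free_solution lam v v' ->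
  free_solution lam (fun x => c * v x) (fun x => c * v' x).
Proof.
move=> [v1 v2]; split; first exact: cderiveZ.
by apply: eq_cderive (cderiveZ c v2) => // x; ring.
Qed.

Lemma free_solutionD lam v v' w w' : free_solution lam v v' -> free_solution lam w w' ->
  free_solution lam (fun x => v x + w x) (fun x => v' x + w' x).
Proof.
move=> [v1 v2] [w1 w2]; split; first exact: cderiveD.
by apply: eq_cderive (cderiveD v2 w2) => // x; ring.
Qed.

(** As [- lam * v] is the derivative of [v'], the integrand is that of the product rule for
    [u * v']. All smoothness rests on [v], so [u] may be any element of the form domain. *)
Lemma free_solution_pairing lam v v' p q u u' : p <= q -> free_solution lam v v' ->
  primitive_on p q u u' -> cmeas `]p, q] u ->
  cintegral mu `]p, q] (fun x => u' x * v' x - lam * (u x * v x)) =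
  u q * v' q - u p * v' p.
Proof.
move=> pq [v1 v2] up mu_.
have vc := cderive_continuous v1; have v'c := cderive_continuous v2.
have v''c : ccontinuous (fun x => - lam * v x)
  by exact: cderive_continuous (cderiveZ _ v1).
have [K v''K] := ccontinuous_bounded pq v''c.
have [_ <-] := primitive_on_by_parts pq up mu_ (cderive_primitive v2 v''c pq)
  (ccontinuous_cmeas _ v'c) v''K.
by apply: eq_cintegral => x _; ring.
Qed.

Definition cexp (z : R[i]) : R[i] :=
  (expR (complex.Re z) * cos (complex.Im z)) +i* (expR (complex.Re z) * sin
    (complex.Im z)).

Lemma cexpD z (w : R[i]) : cexp (z + w) = cexp z * cexp w.
Proof.
by apply: complex_ext; rewrite /cexp ?cReM ?cImM /= cReD cImD expRD ?cosD ?sinD; ring.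
Qed.

Lemma cexp0 : cexp 0 = 1.
Proof. by apply: complex_ext => /=; rewrite expR0 mul1r ?cos0 ?sin0. Qed.

Lemma cabs_cexp z : cabs (cexp z) = expR (complex.Re z).
Proof.
rewrite cabsE /= !exprMn -mulrDr cos2Dsin2 mulr1 sqrtr_sqr ger0_norm// expR_ge0.
Qed.

Lemma cexpNK z : cexp z * cexp (- z) = 1.
Proof. by rewrite -cexpD subrr cexp0. Qed.

Lemma cderive_cexp z : cderive (fun x => cexp (z * x%:C)) (fun x =>
  z * cexp (z * x%:C)).
Proof.
case: z => a b.
split => x /=.
  rewrite (_ : (fun y => _) = (fun y => expR (a * y) * cos (b * y))).
    by apply: is_derive_eq; rewrite /GRing.scale/= !mulr0 subr0 add0r; ring.
  by apply/funext => y; rewrite !mulr0 subr0 add0r.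
rewrite (_ : (fun y => _) = (fun y => expR (a * y) * sin (b * y))).
  by apply: is_derive_eq; rewrite /GRing.scale/= !mulr0 subr0 add0r; ring.
by apply/funext => y; rewrite !mulr0 subr0 add0r.
Qed.

Lemma free_solution_cexp z :
  free_solution (- z ^+ 2) (fun x => cexp (z * x%:C)) (fun x => z * cexp (z * x%:C)).
Proof.
split; first exact: cderive_cexp.
by apply: eq_cderive (cderiveZ z (cderive_cexp z)) => // x; ring.
Qed.

Lemma expR_small (a e : R) : a < 0 -> 0 < e ->
  exists N : R, forall x, N <= x -> expR (a * x) <= e.
Proof.
move=> a0 e0; exists (ln e / a) => x.
by rewrite ler_ndivrMr// mulrC => xe; rewrite -[leRHS]lnK ?posrE// ler_expR.
Qed.

Lemma sqint_cexp z p : complex.Re z < 0 -> sqint `]p, +oo[ (fun x => cexp (z * x%:C)).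
Proof.
move=> z0; split; first exact/ccontinuous_cmeas/cderive_continuous/cderive_cexp.
set a := 2 * complex.Re z.
have a0 : a < 0 by rewrite /a; lra.
have E x : cabs (cexp (z * x%:C)) ^+ 2 = expR (a * x).
  by rewrite cabs_cexp expr2 -expRD; congr expR; rewrite /a cReM /=; ring.
have dF x : is_derive x 1 (fun x => a^-1 * expR (a * x)) (expR (a * x)).
  by apply: is_derive_eq; rewrite /GRing.scale/=; field; rewrite lt_eqF.
have cf : continuous (fun x : R => expR (a * x)).
  by apply: (@is_derive_continuous _ (fun x => a * expR (a * x))) => x;
    apply: is_derive_eq; rewrite /GRing.scale/=; ring.
have sub : `]p, +oo[%classic `<=` `[p, +oo[%classic.
  by move=> x /=; rewrite !in_itv/= !andbT; exact: ltW.
apply: (integrableS (mitv _) (mitv _) sub).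
apply/integrableP; split.
  by apply/measurable_EFinP/measurable_funX/measurable_cabs/ccontinuous_cmeas/cderive_continuous/cderive_cexp.
under eq_integral.
  move=> x _; rewrite /= E ger0_norm ?expR_ge0//; over.
rewrite (@ge0_continuous_FTC2y _ _ (fun x => a^-1 * expR (a * x)) _ 0).
- by rewrite -EFinB ltry.
- by move=> x _; exact: expR_ge0.
- exact: continuous_subspaceT.
- apply/cvgrPdist_le => e e0.
  have ea0 : 0 < e * - a by rewrite mulr_gt0// oppr_gt0.
  have [N HN] := expR_small a0 ea0.
  near=> x; rewrite sub0r normrN normrM (ger0_norm (expR_ge0 _)) ltr0_norm ?invr_lt0//.
  rewrite -invrN.
  by rewrite mulrC ler_pdivrMr ?oppr_gt0// HN//; near: x; exact: nbhs_pinfty_ge.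
- by move=> x _; case: (dF x).
- by apply: cvg_at_right_filter; exact: (is_derive_continuous dF).
- by move=> x _; rewrite derive1E; case: (dF x).
Unshelve. all: by end_near. Qed.

End smooth.

(** * The form domain and the weak equation *)

Section form_domain.
Context {R : realType}.
Local Notation mu := (@lebesgue_measure R).
Local Notation cmeas := (@cmeasurable _ (measurableTypeR R) R).
Implicit Types (p q s t x y : R) (f v : R -> R[i]) (c z lam : R[i]) (u T : H10 R).

Lemma sqint_oc p q f : 0 <= p -> sqint (halfline R) f -> sqint `]p, q] f.
Proof.
move=> p0; apply: sqintS => //.
move=> x /=; rewrite !in_itv/= andbT => /andP[px _]; exact: le_lt_trans px.
Qed.

Lemma H10_sqint u : sqint (halfline R) u.
Proof. exact/square_integrableP/H10_L2. Qed.

Lemma H10_deriv_sqint u : sqint (halfline R) (H10_deriv u).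
Proof. exact/square_integrableP/H10_deriv_L2. Qed.

Lemma sqint_cintegrable p q f : sqint `]p, q] f -> cintegrable mu `]p, q] f.
Proof.
move=> fi.
have f1 : sqint `]p, q] (fun=> 1 : R[i]).
  apply: (@sqint_bounded _ _ _ _ 1); first exact: cmeasurable_cst.
  by move=> x _; rewrite cabsR normr1.
by apply: eq_cintegrable (sqintM (mitv _) fi f1) => // x _; rewrite mulr1.
Qed.

Lemma H10_primitive_on u p q : 0 <= p -> primitive_on p q u (H10_deriv u).
Proof.
move=> p0; split; first exact/sqint_cintegrable/sqint_oc/H10_deriv_sqint.
by move=> x y px xy _; apply: H10_primitive => //; exact: le_trans px.
Qed.

Definition energy u x : R :=
  cabs (u x) ^+ 2 + cabs (H10_deriv u x) ^+ 2.

Lemma energy_ge0 u x : 0 <= energy u x.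
Proof. by rewrite addr_ge0 ?sqr_ge0. Qed.

Lemma energy_integrable u : mu.-integrable (halfline R) (EFin \o energy u).
Proof.
have [_ u1] := H10_sqint u; have [_ u2] := H10_deriv_sqint u.
by apply: eq_integrable (integrableD (mitv _) u1 u2).
Qed.

(** Averaging over [y] in []x, x + 1]] bounds [cabs (u x)] by the integrals of [cabs u] and
    [cabs u'] on a unit interval, and [s <= e / 2 + s ^+ 2 / (2 e)] passes to the energy. The free
    parameter gives boundedness for [e = 1] and, since tails of the energy are small, decay for
    small [e]. *)
Lemma H10_pointwise u x (e : R) : 0 <= x -> 0 < e ->
  cabs (u x) <= e + (2 * e)^-1 * \int[mu]_(y in `]x, +oo[) energy u y.
Proof.
move=> x0 e0.
have x1 : x <= x + 1 by rewrite lerDl.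
set A := `]x, x + 1]%classic : set (measurableTypeR R).
have mA : measurable A by exact: mitv.
have Ax : A `<=` `]x, +oo[%classic.
  by move=> y; rewrite /A/= !in_itv/= andbT => /andP[].
have sub : `]x, +oo[%classic `<=` halfline R by exact: subset_oy.
have ei : mu.-integrable `]x, +oo[ (EFin \o energy u).
  by apply: integrableS (energy_integrable u) => //; exact: mitv.
have eA : mu.-integrable A (EFin \o energy u)
  by apply: integrableS ei => //; exact: mitv.
have uA := integrable_cabs mA (sqint_cintegrable (sqint_oc (x + 1) x0 (H10_sqint u))).
have u'A := integrable_cabs mA (sqint_cintegrable (sqint_oc (x + 1) x0
  (H10_deriv_sqint u))).
have cA (r : R) : mu.-integrable A (EFin \o (fun=> r)).
  apply/integrableP; split; first exact/measurable_EFinP/measurable_cst.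
  under eq_integral do rewrite /=.
  by rewrite integral_cst// lte_mul_pinfty ?lee_fin// lebesgue_oc_lty.
have muA : fine (mu A) = 1 by rewrite /A fine_lebesgue_oc// addrC addKr.
set I' := \int[mu]_(y in A) cabs (H10_deriv u y).
have h1 : cabs (u x) <= \int[mu]_(y in A) cabs (u y) + I'.
  have -> : cabs (u x) = \int[mu]_(y in A) cabs (u x)
    by rewrite Rintegral_cst// muA mulr1.
  have -> : I' = \int[mu]_(y in A) I' by rewrite Rintegral_cst// muA mulr1.
  rewrite -RintegralD//; apply: le_Rintegral => //.
    exact: integrableDR mA uA (cA I').
  move=> y; rewrite /A/= in_itv/= => /andP[xy yx].
  rewrite -[u x](subrK (u y)) addrC; apply: le_trans (cabsD _ _) _; rewrite lerD2l.
  rewrite -cabsN opprB; apply: (primitive_on_le (H10_primitive_on u (x + 1) x0)) => //.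
  exact: ltW.
apply: le_trans h1 _.
rewrite -RintegralD//.
have sq (a : R) : a <= e / 2 + (2 * e)^-1 * a ^+ 2.
  rewrite -subr_ge0 (_ : _ - _ = (2 * e)^-1 * (a - e) ^+ 2).
    by rewrite mulr_ge0 ?sqr_ge0// invr_ge0 mulr_ge0 ?ltW.
  by field; rewrite gt_eqF.
apply: (@le_trans _ _ (\int[mu]_(y in A) (e + (2 * e)^-1 * energy u y))).
  apply: le_Rintegral => //.
  - exact: integrableDR mA uA u'A.
  - exact: integrableDR mA (cA e) (integrableZR _ mA eA).
  - move=> y _; rewrite /energy; have := sq (cabs (u y));
    have := sq (cabs (H10_deriv u y)); lra.
rewrite RintegralD//; last exact: integrableZR.
rewrite Rintegral_cst// muA mulr1 lerD2l RintegralZl//.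
rewrite ler_wpM2l ?invr_ge0 ?mulr_ge0 ?(ltW e0)//.
by apply: subset_le_Rintegral => //; exact: energy_ge0.
Qed.

Lemma H10_bounded u : exists2 K : R, 0 <= K & forall x, 0 <= x -> cabs (u x) <= K.
Proof.
set E := \int[mu]_(y in halfline R) energy u y.
have E0 : 0 <= E by apply: Rintegral_ge0 => x _; exact: energy_ge0.
exists (1 + (2 * 1)^-1 * E).
  by rewrite addr_ge0// mulr_ge0.
move=> x x0; apply: le_trans (H10_pointwise u x0 ltr01) _.
rewrite lerD2l ler_wpM2l//; apply: subset_le_Rintegral;
  [exact: mitv|exact: mitv| |exact: energy_ge0|exact: energy_integrable].
exact: subset_oy.
Qed.

Lemma H10_decay u (e : R) : 0 < e -> exists N : R, forall x, N <= x -> cabs (u x) <= e.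
Proof.
move=> e0; set d := e / 2.
have d0 : 0 < d by rewrite divr_gt0.
(* A tail of at most [2 d^2] makes the second term of [H10_pointwise] at most [d]. *)
have dd : 0 < 2 * d * d by rewrite !mulr_gt0.
have [N HN] := integral_tail_small dd (energy_ge0 u) (energy_integrable u).
exists (Num.max 0 N) => x; rewrite ge_max => /andP[x0 Nx].
apply: le_trans (H10_pointwise u x0 d0) _.
rewrite [leRHS]splitr lerD2l ler_pdivrMl ?mulr_gt0//.
exact: HN.
Qed.

Lemma H10_exists f f' : sqint (halfline R) f -> sqint (halfline R) f' -> f 0 = 0 ->
  (forall q, 0 <= q -> primitive_on 0 q f f') ->
  exists T, H10_fun T = f /\ H10_deriv T = f'.
Proof.
move=> /square_integrableP f2 /square_integrableP f'2 f0 fp.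
have fP x y : 0 <= x -> x <= y -> f y - f x = cintegral mu `]x, y] f'.
  move=> x0 xy; have [_ ->]// := fp y (le_trans x0 xy).
by exists (MkH10 f2 f'2 f0 fP).
Qed.

Lemma H10_conj u : exists T, H10_fun T = (fun x => (u x)^*) /\
  H10_deriv T = (fun x => (H10_deriv u x)^*).
Proof.
apply: H10_exists; [exact/sqintJ/H10_sqint|exact/sqintJ/H10_deriv_sqint| |].
  by rewrite H10_at0 conjc0.
move=> q q0; have [ui uE] := H10_primitive_on u q (lexx 0).
split; first exact: cintegrableJ.
move=> x y x0 xy yq; rewrite cintegralJ//.
  by rewrite -uE// rmorphB.
by apply: cintegrableS ui => //; exact: subset_oc.
Qed.

(** The free part of the weak equation. Without conjugates it is symmetric in [u] and [T], and
    solutions for [lam] itself, not for its conjugate, serve as test functions. *)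
Definition pairing lam u T (x : R) : R[i] :=
  H10_deriv u x * H10_deriv T x - lam * (u x * T x).

Lemma pairing_integrable lam u T : cintegrable mu (halfline R) (pairing lam u T).
Proof.
have h1 := sqintM (mitv _) (H10_deriv_sqint u) (H10_deriv_sqint T).
have h2 := sqintM (mitv _) (H10_sqint u) (H10_sqint T).
exact: cintegrableB (mitv _) h1 (cintegrableZ lam (mitv _) h2).
Qed.

(* Testing against conjugates turns the sesquilinear weak equation into a bilinear
  one. *)
Lemma schrodinger_opP V u lam :
  schrodinger_op V u (fun x => lam * u x) <->
  forall T, cintegral mu (halfline R) (pairing lam u T) =
            cm_integral V (halfline R) (fun x => u x * T x).
Proof.
have split_pairing T : cintegral mu (halfline R) (pairing lam u T) =
    cintegral mu (halfline R) (fun x => H10_deriv u x * H10_deriv T x) -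
    cintegral mu (halfline R) (fun x => lam * u x * T x).
  have h1 := sqintM (mitv _) (H10_deriv_sqint u) (H10_deriv_sqint T).
  have h2 := sqintM (mitv _) (H10_sqint u) (H10_sqint T).
  rewrite /pairing (cintegralB (mitv _) h1 (cintegrableZ lam (mitv _) h2)).
  by congr (_ - _); apply: eq_cintegral => x _; rewrite mulrA.
split => [[_ H] T|H].
  have [T' [T1 T2]] := H10_conj T.
  have K1 x : (T' x)^*%R = T x by rewrite T1; exact: conjcK.
  have K2 x : (H10_deriv T' x)^*%R = H10_deriv T x by rewrite T2; exact: conjcK.
  have := H T'; rewrite /schrodinger_form.
  rewrite (_ : (fun x => H10_deriv u x * _) = fun x =>
    H10_deriv u x * H10_deriv T x); last first.
    by apply/funext => x; congr (_ * _); exact: K2.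
  rewrite (_ : (fun x => u x * _) = fun x => u x * T x); last
    by apply/funext => x; congr (_ * _); exact: K1.
  rewrite (_ : (fun x => lam * u x * _) = fun x => lam * u x * T x); last first.
    by apply/funext => x; congr (_ * _); exact: K1.
  by rewrite split_pairing => <-; rewrite opprB addrC subrK.
split; first exact/square_integrableP/sqintZ/H10_sqint.
move=> T; have [T' [T1 T2]] := H10_conj T.
have := H T'; rewrite split_pairing T1 T2 /schrodinger_form => <-.
by rewrite opprB addrC subrK.
Qed.

End form_domain.

(** * Test functions glued from free solutions *)

Section test_functions.
Context {R : realType}.
Local Notation mu := (@lebesgue_measure R).
Local Notation cmeas := (@cmeasurable _ (measurableTypeR R) R).
Implicit Types (p q s t x y m : R) (f v : R -> R[i]) (c z lam : R[i]) (u T : H10 R).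

Definition glue m f (h : R -> R[i]) x := if x <= m then f x else h x.

Lemma glueL m f h x : x <= m -> glue m f h x = f x.
Proof. by rewrite /glue => ->. Qed.

Lemma glueR m f h x : m < x -> glue m f h x = h x.
Proof. by rewrite /glue leNgt => ->. Qed.

Lemma glueR_eq m f h x : f m = h m -> m <= x -> glue m f h x = h x.
Proof.
by move=> fh; rewrite le_eqVlt => /predU1P[<-|/glueR->//]; rewrite glueL.
Qed.

Lemma in_oc p q x : x \in (`]p, q]%classic : set R) -> p < x /\ x <= q.
Proof. by rewrite inE/= in_itv/= => /andP[]. Qed.

Lemma in_oy p x : x \in (`]p, +oo[%classic : set R) -> p < x.
Proof. by rewrite inE/= in_itv/= andbT. Qed.

(** Derivatives enter only through integrals over half-open intervals, so they are compared on []p,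
    q]] alone; this permits a kink at [p]. *)
Lemma eq_primitive_on p q f f' h h' : (forall x, p <= x -> x <= q -> f x = h x) ->
  (forall x, p < x -> x <= q -> f' x = h' x) ->
  primitive_on p q f f' -> primitive_on p q h h'.
Proof.
move=> fh fh' [fi fE]; split.
  by apply: eq_cintegrable fi => // x /in_oc[? ?]; exact: fh'.
move=> x y px xy yq; rewrite -!fh ?fE//; [|exact: le_trans xy _|exact: le_trans px _].
apply: eq_cintegral => t /in_oc[xt ty]; apply: fh'; first exact: le_lt_trans xt.
exact: le_trans yq.
Qed.

Lemma primitive_on_cat p m q f f' : p <= m -> m <= q ->
  primitive_on p m f f' -> primitive_on m q f f' -> primitive_on p q f f'.
Proof.
move=> pm mq [[r1 i1] E1] [[r2 i2] E2].
have fi : cintegrable mu `]p, q] f'.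
  rewrite (itv_ocU pm mq); split; apply: integrable_setU => //;
  by [exact: mitv|exact: disjoint_ocU].
split => // x y px xy yq.
have [ym|my] := leP y m; first exact: E1.
have [mx|xm] := leP m x; first exact: E2.
rewrite (cintegral_ocU (ltW xm) (ltW my)).
  by rewrite -E1 ?(ltW xm)// -E2 ?(ltW my)//; ring.
by apply: cintegrableS fi => //; exact: subset_oc.
Qed.

Lemma sqint_glue p m f h : p <= m -> sqint `]p, m] f -> sqint `]m, +oo[ h ->
  sqint `]p, +oo[ (glue m f h).
Proof.
move=> pm fi hi; rewrite (itv_oyU pm); apply: sqint_setU => //.
- exact: disjoint_oyU.
- by apply: eq_sqint fi => // x /in_oc[_ xm]; rewrite glueL.
- by apply: eq_sqint hi => // x /in_oy mx; rewrite glueR.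
Qed.

Lemma free_solution_sqint lam v v' p q : p <= q -> free_solution lam v v' ->
  sqint `]p, q] v /\ sqint `]p, q] v'.
Proof.
move=> pq [v1 v2].
have c1 := cderive_continuous v1; have c2 := cderive_continuous v2.
have [K1 HK1] := ccontinuous_bounded pq c1.
have [K2 HK2] := ccontinuous_bounded pq c2.
split; first by apply: (sqint_bounded _ HK1); exact: ccontinuous_cmeas.
by apply: (sqint_bounded _ HK2); exact: ccontinuous_cmeas.
Qed.

Lemma free_solution_primitive lam v v' p q : p <= q -> free_solution lam v v' ->
  primitive_on p q v v'.
Proof. by move=> pq [v1 v2]; apply: cderive_primitive => //;
  exact: cderive_continuous v2. Qed.

Lemma H10_cmeas u p q : 0 <= p -> cmeas `]p, q] u.
Proof. by move=> p0; have [] := sqint_oc q p0 (H10_sqint u). Qed.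

Lemma pairing_on lam u T v v' p q : 0 <= p -> p <= q -> free_solution lam v v' ->
  (forall x, p < x -> x <= q -> T x = v x) ->
  (forall x, p < x -> x <= q -> H10_deriv T x = v' x) ->
  cintegral mu `]p, q] (pairing lam u T) = u q * v' q - u p * v' p.
Proof.
move=> p0 pq vs Tv Tv'.
rewrite -(free_solution_pairing pq vs (H10_primitive_on u q p0) (H10_cmeas u q p0)).
by apply: eq_cintegral => x /in_oc[px xq]; rewrite /pairing Tv// Tv'.
Qed.

Lemma broken_solution lam v1 v1' v2 v2' m : 0 <= m ->
  free_solution lam v1 v1' -> free_solution lam v2 v2' ->
  v1 0 = 0 -> v1 m = v2 m ->
  sqint `]m, +oo[ v2 -> sqint `]m, +oo[ v2' ->
  (forall e : R, 0 < e -> exists N : R, forall x, N <= x -> cabs (v2' x) <= e) ->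
  exists T, [/\ forall x, x <= m -> T x = v1 x, forall x, m <= x -> T x = v2 x &
    forall u, cintegral mu (halfline R) (pairing lam u T) = u m * (v1' m - v2' m)].
Proof.
move=> m0 s1 s2 v10 v12 L L' decay.
have [l1 l1'] := free_solution_sqint m0 s1.
have [|||q q0|T [TE T'E]] := @H10_exists _ (glue m v1 v2) (glue m v1' v2').
- exact: sqint_glue.
- exact: sqint_glue.
- by rewrite glueL.
- apply: (@primitive_onS _ 0 (Num.max m q)) => //; first by rewrite le_max lexx orbT.
  have mM : m <= Num.max m q by rewrite le_max lexx.
  apply: (primitive_on_cat m0 mM).
    apply: eq_primitive_on (free_solution_primitive m0 s1).
      by move=> x _ xm; rewrite glueL.
    by move=> x _ xm; rewrite glueL.
  apply: eq_primitive_on (free_solution_primitive mM s2).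
    by move=> x mx _; rewrite glueR_eq.
  by move=> x mx _; rewrite glueR.
exists T; split.
- by move=> x xm; rewrite TE glueL.
- by move=> x mx; rewrite TE glueR_eq.
move=> u; have pi_ := pairing_integrable lam u T.
rewrite (cintegral_oyU m0 pi_).
rewrite (pairing_on u (lexx 0) m0 s1); last 2 first.
- by move=> x _ xm; rewrite TE glueL.
- by move=> x _ xm; rewrite T'E glueL.
rewrite H10_at0 mul0r subr0.
rewrite (@cintegral_oy_lim _ m _ (fun q =>
  u q * v2' q - u m * v2' m) (- (u m * v2' m))).
- by ring.
- by apply: cintegrableS pi_ => //; exact: subset_oy.
- move=> q mq; apply: (pairing_on u m0 mq s2).
    by move=> x mx _; rewrite TE glueR.
  by move=> x mx _; rewrite T'E glueR.
move=> e e0; have [K K0 uK] := H10_bounded u.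
have K1 : 0 < K + 1 by rewrite ltr_wpDl.
have [N HN] := decay _ (divr_gt0 e0 K1).
exists (Num.max 0 N) => q; rewrite ge_max => /andP[q0 Nq].
rewrite opprK subrK cabsM.
apply: le_trans (ler_pM (cabs_ge0 _) (cabs_ge0 _) (uK _ q0) (HN _ Nq)) _.
by rewrite mulrCA ler_piMr ?(ltW e0)// ler_pdivrMr// mul1r lerDl.
Qed.

(** Compactly supported counterpart of [broken_solution], for [lam] without a decaying free
    solution. The zero function is a free solution for every [lam], so the outer pieces contribute
    nothing, and each of the kinks at [p], [m] and [q] contributes a point value of [u]. *)
Lemma hat_solution lam v1 v1' v2 v2' p m q : 0 <= p -> p <= m -> m <= q ->
  free_solution lam v1 v1' -> free_solution lam v2 v2' ->
  v1 p = 0 -> v1 m = v2 m -> v2 q = 0 ->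
  exists T, (forall x, x <= p -> T x = 0) /\
    forall u, cintegral mu (halfline R) (pairing lam u T) =
      u m * (v1' m - v2' m) - u p * v1' p + u q * v2' q.
Proof.
move=> p0 pm mq s1 s2 v1p v12 v2q.
have [l1 l1'] := free_solution_sqint pm s1.
have [l2 l2'] := free_solution_sqint mq s2.
pose zero := fun _ : R => 0 : R[i].
have zs : free_solution lam zero zero.
  by split; split => x /=; rewrite ?mulr0 /=; apply: is_derive_cst.
have [z1 _] := free_solution_sqint p0 zs.
have zq := sqint0 (R := R) `]q, +oo[.
pose h := glue p zero (glue m v1 (glue q v2 zero)).
pose h' := glue p zero (glue m v1' (glue q v2' zero)).
have pq := le_trans pm mq; have q0 := le_trans p0 pq.
have h1 x : x <= p -> h x = 0 by move=> xp; rewrite /h glueL.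
have h2 x : p <= x -> x <= m -> h x = v1 x.
  move=> px xm; rewrite /h glueR_eq//; first by rewrite glueL.
  by rewrite glueL.
have h3 x : m <= x -> x <= q -> h x = v2 x.
  move=> mx xq.
  have g3 : glue m v1 (glue q v2 zero) x = v2 x by rewrite glueR_eq// glueL.
  rewrite /h glueR_eq//; first by rewrite glueL.
  exact: le_trans mx.
have h4 x : q < x -> h x = 0.
  move=> qx; rewrite /h glueR; last exact: le_lt_trans qx.
  by rewrite glueR ?glueR// (le_lt_trans mq).
have h1' x : x <= p -> h' x = 0 by move=> xp; rewrite /h' glueL.
have h2' x : p < x -> x <= m -> h' x = v1' x.
  by move=> px xm; rewrite /h' glueR// glueL.
have h3' x : m < x -> x <= q -> h' x = v2' x.
  by move=> mx xq; rewrite /h' glueR ?(le_lt_trans pm)// glueR// glueL.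
have h4' x : q < x -> h' x = 0.
  move=> qx; rewrite /h' glueR; last exact: le_lt_trans qx.
  by rewrite glueR ?glueR// (le_lt_trans mq).
have [||||T [TE T'E]] := @H10_exists _ h h'.
- by do 3 apply: sqint_glue => //.
- by do 3 apply: sqint_glue => //.
- exact: h1.
- move=> Q Q0; apply: (@primitive_onS _ 0 (Num.max q Q)) => //.
    by rewrite le_max lexx orbT.
  have qM : q <= Num.max q Q by rewrite le_max lexx.
  apply: (primitive_on_cat q0 qM).
    apply: (primitive_on_cat p0 pq).
      apply: eq_primitive_on (free_solution_primitive p0 zs).
        by move=> x _ xp; rewrite h1.
      by move=> x _ xp; rewrite h1'.
    apply: (primitive_on_cat pm mq).
      apply: eq_primitive_on (free_solution_primitive pm s1).
        by move=> x px xm; rewrite h2.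
      by move=> x px xm; rewrite h2'.
    apply: eq_primitive_on (free_solution_primitive mq s2).
      by move=> x mx xq; rewrite h3.
    by move=> x mx xq; rewrite h3'.
  apply: eq_primitive_on (free_solution_primitive qM zs).
    move=> x; rewrite le_eqVlt => /predU1P[<- _|qx _]; last by rewrite h4.
    by rewrite h3// v2q.
  by move=> x qx _; rewrite h4'.
exists T; split; first by move=> x xp; rewrite TE h1.
move=> u; have pi_ := pairing_integrable lam u T.
have pis a : 0 <= a -> cintegrable mu `]a, +oo[ (pairing lam u T).
  by move=> a0; apply: cintegrableS pi_ => //; exact: subset_oy.
rewrite (cintegral_oyU p0 pi_) (cintegral_oyU pm (pis _ p0)).
rewrite (cintegral_oyU mq (pis _ (le_trans p0 pm))).
rewrite (pairing_on u (lexx 0) p0 zs); last 2 first.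
- by move=> x _ xp; rewrite TE h1.
- by move=> x _ xp; rewrite T'E h1'.
rewrite (pairing_on u p0 pm s1); last 2 first.
- by move=> x px xm; rewrite TE h2// ltW.
- by move=> x px xm; rewrite T'E h2'.
rewrite (pairing_on u (le_trans p0 pm) mq s2); last 2 first.
- by move=> x mx xq; rewrite TE h3// ltW.
- by move=> x mx xq; rewrite T'E h3'.
rewrite (_ : cintegral mu `]q, +oo[ _ = 0).
  by rewrite /zero; ring.
rewrite -[RHS](cintegral0 mu `]q, +oo[); apply: eq_cintegral => x /in_oy qx.
by rewrite /pairing TE T'E h4// h4'// !mulr0 subr0.
Qed.

End test_functions.

(** * Integration against complex measures *)

Section charges.
Context d (T : measurableType d) (R : realType).
Implicit Types (D : set T) (V : complex_measure T R) (f : T -> R[i]).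

Lemma bigcup_ord_bigsetU n (A : 'I_n -> set T) :
  \bigcup_i A i = \big[setU/set0]_(i <- enum 'I_n) A i.
Proof.
rewrite -bigcup_seq; apply/seteqP; split => x [i _ Aix]; exists i => //=.
by rewrite mem_enum.
Qed.

Lemma Rintegral_partition (m : {measure set T -> \bar R}) n (A : 'I_n ->
  set T) D (h : T -> R) :
  (forall i, measurable (A i)) -> trivIset setT A -> \bigcup_i A i = D ->
  m.-integrable D (EFin \o h) ->
  \int[m]_(x in D) h x = \sum_(i < n) \int[m]_(x in A i) h x.
Proof.
move=> mA tA AD hi.
have AiD i : A i `<=` D by move=> x Ax; rewrite -AD; exists i.
have mD : measurable D.
  by rewrite -AD bigcup_ord_bigsetU; apply: bigsetU_measurable.
rewrite /Rintegral -AD bigcup_ord_bigsetU integral_bigsetU_EFin//.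
- rewrite -sum_fine ?big_enum//= => i _.
  by apply: integrable_fin_num => //; apply: integrableS hi.
- exact: enum_uniq.
- exact: sub_trivIset tA.
- by rewrite -bigcup_ord_bigsetU AD; have /measurable_int := hi.
Qed.

Lemma finite_measure_integrable (m : {finite_measure set T -> \bar R}) D (h : T ->
  R) (K : R) :
  measurable D -> measurable_fun D h -> (forall x, D x -> `|h x| <= K) ->
  m.-integrable D (EFin \o h).
Proof.
move=> mD mh hK; apply: measurable_bounded_integrable => //.
  by rewrite ltey_eq fin_num_measure.
exists K; split; first exact: num_real.
by move=> L KL x Dx /=; rewrite (le_trans (hK _ Dx))// ltW.
Qed.

Lemma measure_partition_error (m : {finite_measure set T -> \bar R}) n (A : 'I_n ->
  set T) D
    (h : T -> R) (a : 'I_n -> R) (K e : R) :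
  (forall i, measurable (A i)) -> trivIset setT A -> \bigcup_i A i = D ->
  measurable_fun D h -> (forall x, D x -> `|h x| <= K) ->
  (forall i x, A i x -> `|h x - a i| <= e) ->
  `|\int[m]_(x in D) h x - \sum_(i < n) a i * fine (m (A i))| <= e * fine (m D).
Proof.
move=> mA tA AD mh hK ha.
have AiD i : A i `<=` D by move=> x Ax; rewrite -AD; exists i.
have mD : measurable D.
  by rewrite -AD bigcup_ord_bigsetU; apply: bigsetU_measurable.
have hi := finite_measure_integrable m mD mh hK.
have ci B (r : R) : measurable B -> m.-integrable B (EFin \o (fun=> r)).
  by move=> mB; apply: (@finite_measure_integrable m B _ `|r|).
rewrite (Rintegral_partition mA tA AD hi) -sumrB.
have -> : fine (m D) = \sum_(i < n) fine (m (A i)).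
  have := Rintegral_partition mA tA AD (ci D 1 mD).
  rewrite Rintegral_cst// mul1r => ->; apply: eq_bigr => i _.
  by rewrite Rintegral_cst// mul1r.
rewrite mulr_sumr; apply: le_trans (ler_norm_sum _ _ _) _; apply: ler_sum => i _.
rewrite -!Rintegral_cst// -RintegralB//; [|exact: integrableS hi|exact: ci].
have hci : m.-integrable (A i) (EFin \o (fun x => h x - a i)).
  by apply: eq_integrable (integrableB _ (integrableS mD (mA i) (@AiD i) hi) (ci _ (a
    i) (mA i))).
apply: le_trans (le_normr_Rintegral _ hci) _ => //.
apply: le_Rintegral => //; first exact: integrable_norm.
  exact: ci.
exact: ha.
Qed.

(** The total variation of the charge [nu] on [D]; it serves to control approximation errors. *)
Definition jordan_mass (nu : {charge set T -> \bar R}) D : R :=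
  fine (jordan_pos (hahn_setsP nu) D) + fine (jordan_neg (hahn_setsP nu) D).

Lemma jordan_mass_ge0 nu D : 0 <= jordan_mass nu D.
Proof. by rewrite addr_ge0// fine_ge0. Qed.

Lemma charge_partition_error (nu : {charge set T -> \bar R}) n (A : 'I_n -> set T) D
    (h : T -> R) (a : 'I_n -> R) (K e : R) :
  (forall i, measurable (A i)) -> trivIset setT A -> \bigcup_i A i = D ->
  measurable_fun D h -> (forall x, D x -> `|h x| <= K) ->
  (forall i x, A i x -> `|h x - a i| <= e) ->
  `|charge_integral nu D h - \sum_(i < n) a i * fine (nu (A i))| <= e * jordan_mass
    nu D.
Proof.
move=> mA tA AD mh hK ha.
have P := @measure_partition_error (jordan_pos (hahn_setsP nu)) _ _ _ _ _ _ _ mA tA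
  AD mh hK ha.
have N := @measure_partition_error (jordan_neg (hahn_setsP nu)) _ _ _ _ _ _ _ mA tA
  AD mh hK ha.
have -> : \sum_(i < n) a i * fine (nu (A i)) =
    \sum_(i < n) a i * fine (jordan_pos (hahn_setsP nu) (A i)) -
    \sum_(i < n) a i * fine (jordan_neg (hahn_setsP nu) (A i)).
  rewrite -sumrB; apply: eq_bigr => i _.
  rewrite (jordan_decomp (hahn_setsP nu))// /cadd/= cscaleN1 fineD/= ?fineN ?mulrBr//.
    exact: fin_num_measure.
  by rewrite fin_numN; exact: fin_num_measure.
rewrite /charge_integral /jordan_mass mulrDr.
apply: le_trans (lerD P N); apply: le_trans (ler_normB _ _).
by rewrite le_eqVlt; apply/orP; left; apply/eqP; congr `|_|; ring.
Qed.

Lemma cm_partition_error V n (A : 'I_n -> set T) D f (a : 'I_n -> R[i]) (K e : R) :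
  (forall i, measurable (A i)) -> trivIset setT A -> \bigcup_i A i = D ->
  cmeasurable D f -> (forall x, D x -> cabs (f x) <= K) ->
  (forall i x, A i x -> `|complex.Re (f x) - complex.Re (a i)| <= e) ->
  (forall i x, A i x -> `|complex.Im (f x) - complex.Im (a i)| <= e) ->
  cabs (cm_integral V D f - \sum_(i < n) a i * cm_val V (A i)) <=
  2 * e * (jordan_mass (cm_re V) D + jordan_mass (cm_im V) D).
Proof.
move=> mA tA AD [mr mi] fK ar ai.
have rK x : D x -> `|complex.Re (f x)| <= K by move=> Dx;
  exact: le_trans (Re_le_cabs _) (fK _ Dx).
have iK x : D x -> `|complex.Im (f x)| <= K by move=> Dx;
  exact: le_trans (Im_le_cabs _) (fK _ Dx).
have rr := @charge_partition_error (cm_re V) _ _ _ _ _ _ _ mA tA AD mr rK ar.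
have ri := @charge_partition_error (cm_re V) _ _ _ _ _ _ _ mA tA AD mi iK ai.
have ir := @charge_partition_error (cm_im V) _ _ _ _ _ _ _ mA tA AD mr rK ar.
have ii := @charge_partition_error (cm_im V) _ _ _ _ _ _ _ mA tA AD mi iK ai.
have -> : \sum_(i < n) a i * cm_val V (A i) =
    (\sum_(i < n) complex.Re (a i) * fine (cm_re V (A i)) -
     \sum_(i < n) complex.Im (a i) * fine (cm_im V (A i))) +i*
    (\sum_(i < n) complex.Im (a i) * fine (cm_re V (A i)) +
     \sum_(i < n) complex.Re (a i) * fine (cm_im V (A i))).
  rewrite -sumrB -big_split/=.
  elim/big_ind3 : _ => //= [x1 x2 [a1 b1] y1 y2 [a2 b2]|i _].
    by move=> -[-> ->] [-> ->].
  by apply: complex_ext; rewrite ?cReM ?cImM /= // addrC.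
apply: le_trans (cabs_le _) _ => /=.
move: rr ri ir ii; rewrite !ler_norml => /andP[? ?] /andP[? ?] /andP[? ?] /andP[? ?].
have -> : 2 * e * (jordan_mass (cm_re V) D + jordan_mass (cm_im V) D) =
  (e * jordan_mass (cm_re V) D + e * jordan_mass (cm_im V) D) +
  (e * jordan_mass (cm_re V) D + e * jordan_mass (cm_im V) D) by ring.
by apply: lerD; rewrite ler_norml; apply/andP; split; lra.
Qed.

Lemma cm_val_sum_le V n (A : 'I_n -> set T) D (v : R) :
  (forall i, measurable (A i)) -> trivIset setT A -> \bigcup_i A i = D ->
  cm_variation V D = v%:E -> \sum_(i < n) cabs (cm_val V (A i)) <= v.
Proof.
move=> mA tA AD Vv; rewrite -lee_fin -Vv; apply: ereal_sup_ubound.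
by exists n, A; split.
Qed.

(** The pieces are the preimages under [f] of the cells of a square grid of mesh [e] covering
    [[- M, M]^2]. *)
Lemma grid_partition D f (M e : R) : measurable D -> cmeasurable D f ->
  0 < e -> 0 <= M -> (forall x, D x -> cabs (f x) <= M) ->
  exists n (A : 'I_n -> set T) (a : 'I_n -> R[i]),
  [/\ forall i, measurable (A i), trivIset setT A, \bigcup_i A i = D,
    forall i, cabs (a i) <= M & forall i x, A i x ->
     `|complex.Re (f x) - complex.Re (a i)| <= e /\ `|complex.Im (f x) - complex.Im
       (a i)| <= e].
Proof.
move=> mD [mr mi] e0 M0 fM.
(* [K] half-open cells of length [e] starting at [- M] reach strictly beyond [M], so the value [M]
   itself is covered. *)
pose K := (Num.truncn (2 * M / e)).+1.
pose J (k : nat) : set R := `[e * k%:R - M, e * k.+1%:R - M[%classic.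
have Jdis (i j : nat) (r : R) : J i r -> J j r -> i = j.
  wlog ij : i j / (i <= j)%N.
    by move=> H; case: (leqP i j) => ij ri rj; [exact: H|apply/esym/H => //;
      exact: ltnW].
  rewrite /J/= !in_itv/= => /andP[_ h1] /andP[h2 _]; apply/eqP; rewrite eqn_leq ij/=.
  rewrite leqNgt; apply/negP => ij'.
  have : e * i.+1%:R <= e * j%:R by rewrite ler_pM2l// ler_nat.
  by lra.
have Jcov (r : R) : `|r| <= M -> exists k : 'I_K, J k r.
  rewrite ler_norml => /andP[r1 r2].
  have q0 : 0 <= (r + M) / e by rewrite divr_ge0 ?(ltW e0)//; lra.
  have /andP[k1 k2] := truncn_itv q0.
  have kK : (Num.truncn ((r + M) / e) < K)%N.
    rewrite ltnS; apply: le_truncn; rewrite ler_pM2r ?invr_gt0//; lra.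
  exists (Ordinal kK); rewrite /J /= in_itv/=.
  move: k1 k2; rewrite ler_pdivlMr// ltr_pdivrMr// => k1 k2.
  by apply/andP; split; [rewrite mulrC|rewrite (mulrC e)]; lra.
pose I : finType := ('I_K * 'I_K)%type.
pose B (p : I) := D `&` (fun x => complex.Re (f x)) @^-1` J p.1 `&`
   (D `&` (fun x => complex.Im (f x)) @^-1` J p.2).
have mB p : measurable (B p).
  by apply: measurableI; [apply: mr|apply: mi] => //; exact: measurable_itv.
(* A sampled value of [f] rather than a grid point, which could exceed [M] in modulus; empty cells
   get [0]. *)
pose b (p : I) : R[i] := if pselect (exists x,
  B p x) is left H then f (projT1 (cid H)) else 0.
exists #|I|, (fun i => B (enum_val i)), (fun i => b (enum_val i)); split.
- by move=> i; exact: mB.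
- move=> i j _ _ [x [[[_ xi1] [_ xi2]] [[_ xj1] [_ xj2]]]].
  apply: enum_val_inj; move: xi1 xi2 xj1 xj2.
  case: (enum_val i) => i1 i2; case: (enum_val j) => j1 j2 /= xi1 xi2 xj1 xj2.
  by congr (_, _); apply: val_inj; apply: Jdis; eassumption.
- apply/seteqP; split => [x [i _ [[]]]//|x Dx].
  have [k1 h1] := Jcov _ (le_trans (Re_le_cabs _) (fM _ Dx)).
  have [k2 h2] := Jcov _ (le_trans (Im_le_cabs _) (fM _ Dx)).
  by exists (enum_rank ((k1, k2) : I)) => //; rewrite enum_rankK; split; split.
- move=> i; rewrite /b; case: pselect => [H|_].
    by case: (cid H) => x [[Dx _] _] /=; exact: fM.
  by rewrite (_ : cabs _ = 0)//; apply/eqP; rewrite cabs_eq0.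
- move=> i x Bx; rewrite /b; case: pselect => [H|nH]; last
  by exfalso; apply: nH; exists x.
  case: (cid H) => y By /=.
  move: Bx By => [[_ x1] [_ x2]] [[_ y1] [_ y2]].
  move: x1 x2 y1 y2; rewrite /J /= !in_itv/= -!natr1 =>
    /andP[? ?] /andP[? ?] /andP[? ?] /andP[? ?].
  by split; rewrite ler_norml; apply/andP; split; lra.
Qed.

Lemma cabs_sum n (a : 'I_n ->
  R[i]) : cabs (\sum_(i < n) a i) <= \sum_(i < n) cabs (a i).
Proof.
elim/big_ind2 : _ => //.
- by rewrite (_ : cabs _ = 0)//; apply/eqP; rewrite cabs_eq0.
- by move=> x y z w xy zw; apply: le_trans (cabsD _ _) _; exact: lerD.
Qed.

(** Estimating the four real integrals one by one would lose a constant. Step functions keep it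
    sharp, since [\sum a_i V(A_i)] is at most [M * v] by the definition of the variation; the
    approximation error involves the Jordan masses, which may exceed [v], but can be made
    arbitrarily small. *)
Lemma cm_integral_le V D f (M v : R) : measurable D -> cmeasurable D f -> 0 <= M ->
  (forall x, D x -> cabs (f x) <= M) -> cm_variation V D = v%:E ->
  cabs (cm_integral V D f) <= M * v.
Proof.
move=> mD mf M0 fM Vv.
set W := jordan_mass (cm_re V) D + jordan_mass (cm_im V) D.
have W0 : 0 <= W by rewrite addr_ge0// jordan_mass_ge0.
apply/ler_addgt0Pr => e e0.
(* The [+ 1] keeps the mesh positive when [W = 0]; the total error is then [e * (W / (W + 1))]. *)
have e'0 : 0 < e / (2 * (W + 1)) by rewrite divr_gt0// mulr_gt0// ltr_wpDl.
have [n [A [a [mA tA AD aM fa]]]] := grid_partition mD mf e'0 M0 fM.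
have := @cm_partition_error V _ _ _ _ _ _ _ mA tA AD mf fM (fun i x Ax =>
  (fa i x Ax).1) (fun i x Ax => (fa i x Ax).2).
set S := \sum_(i < n) _ => h.
rewrite -[cm_integral _ _ _](subrK S) addrC; apply: le_trans (cabsD _ _) _; apply: lerD.
  apply: le_trans (cabs_sum _) _.
  apply: (@le_trans _ _ (\sum_(i < n) M * cabs (cm_val V (A i)))).
    by apply: ler_sum => i _; rewrite cabsM ler_wpM2r ?cabs_ge0.
  by rewrite -mulr_sumr ler_wpM2l// (cm_val_sum_le mA tA AD Vv).
apply: le_trans h _; rewrite -/W.
have -> : 2 * (e / (2 * (W + 1))) * W = e * (W / (W + 1)).
  by field; rewrite gt_eqF// ltr_wpDl.
by rewrite ler_piMr ?(ltW e0)// ler_pdivrMr ?ltr_wpDl// mul1r lerDl.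
Qed.

End charges.

(** * Integrable potentials and point masses *)

Section potentials.
Context {R : realType}.
Local Notation mu := (@lebesgue_measure R).
Local Notation D := (halfline R).
Implicit Types (b : R) (c : R[i]) (A : set (measurableTypeR R)).

Lemma cm_val_of_L1 (v : L1_potential R) A : measurable A -> A `<=` D ->
  cm_val (measure_of_L1 v) A = cintegral mu A v.
Proof.
move=> mA AD; apply: complex_ext => /=.
  rewrite /induced_charge /Rintegral; congr fine; apply: eq_integral => x xA.
  by rewrite patchE mem_set//; apply: AD; rewrite inE in xA.
rewrite /induced_charge /Rintegral; congr fine; apply: eq_integral => x xA.
by rewrite patchE mem_set//; apply: AD; rewrite inE in xA.
Qed.

Lemma cm_variation_of_L1 (v : L1_potential R) :
  (cm_variation (measure_of_L1 v) D <= (L1_norm v)%:E)%E.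
Proof.
have vi : cintegrable mu D v by split; [exact: L1_re|exact: L1_im].
apply: ge_ereal_sup => _ [n [A [mA tA AD ->]]].
have AiD i : A i `<=` D by move=> x Ax; rewrite -AD; exists i.
rewrite lee_fin /L1_norm.
rewrite (Rintegral_partition mA tA AD); last exact: integrable_cabs (mitv _) vi.
apply: ler_sum => i _; rewrite cm_val_of_L1//.
by apply: le_cabs_cintegral => //; apply: cintegrableS vi => //; exact: mitv.
Qed.

Lemma scaled_dirac_charge (r b : R) A :
  cscale r (charge_of_finite_measure
    (\d_(b : measurableTypeR R) : {finite_measure set (measurableTypeR R) ->
      \bar R})) A =
  (r * (b \in A)%:R)%:E.
Proof. by rewrite /cscale /charge_of_finite_measure /= /dirac indicE -EFinM. Qed.

Lemma cm_val_delta c b A : cm_val (cdelta c (b : measurableTypeR R)) A =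
  if b \in A then c else 0.
Proof.
transitivity ((complex.Re c * (b \in A)%:R) +i* (complex.Im c * (b \in A)%:R)).
  by rewrite /cm_val; congr (_ +i* _); exact: congr1 fine (scaled_dirac_charge _ _ _).
by case: ifP => _; rewrite ?mulr1 ?mulr0//; case: c.
Qed.

Lemma cm_variation_delta c b : 0 < b ->
  cm_variation (cdelta c (b : measurableTypeR R)) D = (cabs c)%:E.
Proof.
move=> b0.
have Db : D b by rewrite /= in_itv/= b0.
have c0 : cabs (0 : R[i]) = 0 by apply/eqP; rewrite cabs_eq0.
apply/eqP; rewrite eq_le; apply/andP; split.
  apply: ge_ereal_sup => _ [n [A [mA tA AD ->]]]; rewrite lee_fin.
  have [i _ Aib] : (\bigcup_i A i) b by rewrite AD.
  rewrite (eq_bigr (fun j => if j == i then cabs c else 0)).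
    by rewrite -big_mkcond big_pred1_eq.
  move=> j _; rewrite cm_val_delta; case: eqVneq => [->|ji]; first by rewrite mem_set.
  rewrite ifF//; apply/negbTE; rewrite notin_setE => Ajb.
  by move/eqP: ji; apply; apply: tA => //; exists b.
apply: ereal_sup_ubound; exists 1%N, (fun=> D); split.
- by move=> _; exact: mitv.
- by move=> i j _ _ _; rewrite !ord1.
- by apply/seteqP; split => [x []//|x Dx]; exists ord0.
- by rewrite big_ord1 cm_val_delta mem_set.
Qed.

(** Stated for any [m] that agrees with a scaled Dirac mass on measurable sets, which is the form in
    which the Jordan parts become available. *)
Lemma Rintegral_dirac_scaled (m : {measure set (measurableTypeR R) -> \bar R}) (b s : R)
    (h : R -> R) : 0 <= s -> (forall A, measurable A -> m A = (s * (b \in A)%:R)%:E) ->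
  0 < b -> measurable_fun D h ->
  \int[m]_(x in D) h x = s * h b.
Proof.
move=> s0 mE b0 mh.
have Db : D b by rewrite /= in_itv/= b0.
rewrite /Rintegral (eq_measure_integral (mscale (NngNum s0) (\d_(b : measurableTypeR
  R)))); last first.
  by move=> A mA _; rewrite mE// /mscale/= diracE EFinM.
have mE' : measurable_fun (D : set (measurableTypeR R)) (EFin \o h)
  by exact/measurable_EFinP.
have mp := measurable_funepos mE'; have mn := measurable_funeneg mE'.
rewrite integralE !ge0_integral_mscale// !integral_dirac// diracE mem_set// !mul1e /=.
rewrite funeposE funenegE -EFinN -!EFin_max -!EFinM -EFinB /= -mulrBr.
congr (_ * _); have [h0|h0] := leP 0 (h b).
  by rewrite max_r ?subr0// oppr_le0.
by rewrite max_l ?oppr_ge0 ?(ltW h0)// sub0r opprK.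
Qed.

(** The Hahn sets are arbitrary, but exactly one of them contains [b], and the sign of [nu] on that
    set fixes the sign of [r]. The corresponding Jordan part is [|r|] times the Dirac mass and the
    other one is zero. *)
Lemma jordan_integral_dirac (nu : {charge set (measurableTypeR R) -> \bar R}) P N
    (PN : hahn_decomposition nu P N) (r b : R) (h : R -> R) :
  (forall A, nu A = (r * (b \in A)%:R)%:E) -> 0 < b -> measurable_fun D h ->
  \int[jordan_pos PN]_(x in D) h x - \int[jordan_neg PN]_(x in D) h x = r * h b.
Proof.
move=> nuE b0 mh; have [[mP posP] [mN negN] PUN PIN] := PN.
have [bP|bP] := boolP (b \in P).
  have bN : b \notin N.
    by apply/negP => bN; have : (P `&` N) b by [split; exact: set_mem]; rewrite PIN.
  have r0 : 0 <= r by have := posP _ mP (@subset_refl _ P);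
    rewrite nuE bP mulr1 lee_fin.
  rewrite (@Rintegral_dirac_scaled _ b r)// ?(@Rintegral_dirac_scaled _ b 0)// ?mul0r
    ?subr0//.
    move=> A mA; transitivity (- crestr0 nu mN A)%E; first exact: (cjordan_negE PN A).
  rewrite /crestr0 mem_set// /crestr/= nuE.
  by rewrite mul0r in_setI (negbTE bN) andbF mulr0 oppe0.
  move=> A mA; transitivity (crestr0 nu mP A); first exact: (cjordan_posE PN A).
  rewrite /crestr0 mem_set// /crestr/= nuE.
  by rewrite in_setI bP andbT.
have bN : b \in N.
  have : (P `|` N) b by rewrite PUN.
  by move=> [/mem_set bP'|/mem_set//]; rewrite bP' in bP.
have r0 : 0 <= - r.
  by have := negN _ mN (@subset_refl _ N); rewrite nuE bN mulr1 lee_fin oppr_ge0.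
rewrite (@Rintegral_dirac_scaled _ b 0)// ?(@Rintegral_dirac_scaled _ b (- r))//
  ?mul0r ?sub0r ?mulNr ?opprK//.
  move=> A mA; transitivity (- crestr0 nu mN A)%E; first exact: (cjordan_negE PN A).
  rewrite /crestr0 mem_set// /crestr/= nuE.
  by rewrite in_setI bN andbT -EFinN mulNr.
move=> A mA; transitivity (crestr0 nu mP A); first exact: (cjordan_posE PN A).
  rewrite /crestr0 mem_set// /crestr/= nuE.
by rewrite in_setI (negbTE bP) andbF mulr0 mul0r.
Qed.

Lemma cm_integral_delta c b (f : R -> R[i]) : 0 < b ->
  @cmeasurable _ (measurableTypeR R) R D f ->
  cm_integral (cdelta c (b : measurableTypeR R)) D f = c * f b.
Proof.
move=> b0 [mr mi]; rewrite /cm_integral /charge_integral.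
have J := fun r h mh =>
  @jordan_integral_dirac _ _ _ (hahn_setsP (cscale r (charge_of_finite_measure
    (\d_(b : measurableTypeR R) : {finite_measure set (measurableTypeR R) -> \bar R}))))
    r b h (scaled_dirac_charge r b) b0 mh.
rewrite (J _ _ mr) (J _ _ mi) (J _ _ mr) (J _ _ mi).
by apply: complex_ext; rewrite ?cReM ?cImM.
Qed.

End potentials.

(** * Green function and eigenvalues of point interactions *)

Section green.
Context {R : realType}.
Local Notation mu := (@lebesgue_measure R).
Local Notation D := (halfline R).
Implicit Types (x y b : R) (c z lam : R[i]) (u T : H10 R) (V : complex_measure
  (measurableTypeR R) R).

(** In one formula [T y = (e^(z (x0 + y)) - e^(z |x0 - y|)) / (2 z)]: the whole-line kernel minus
    its reflection at [0]. The coefficients give continuity and a unit jump of the derivative at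
    [x0], which [broken_solution] turns into evaluation at [x0]. *)
Lemma green_function z x0 : complex.Re z < 0 -> 0 <= x0 -> exists T, [/\
  forall y, y <= x0 -> T y = (2 * z)^-1 * cexp (z * x0%:C) * (cexp (z * y%:C) - cexp
    (- z * y%:C)),
  forall y, x0 <= y -> T y = (2 * z)^-1 * (cexp (z * x0%:C) - cexp (- z * x0%:C)) *
    cexp (z * y%:C) &
  forall u, cintegral mu D (pairing (- z ^+ 2) u T) = u x0].
Proof.
move=> z0 x00.
have zn : z != 0 by apply/eqP => zE; move: z0; rewrite zE ltxx.
set a1 := (2 * z)^-1 * cexp (z * x0%:C).
set a2 := (2 * z)^-1 * (cexp (z * x0%:C) - cexp (- z * x0%:C)).
have sz := free_solution_cexp z.
have snz : free_solution (- z ^+ 2) (fun x => cexp (- z * x%:C)) (fun x =>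
  - z * cexp (- z * x%:C)).
  by rewrite -(sqrrN z); exact: free_solution_cexp.
have s1 := free_solutionZ a1 (free_solutionD sz (free_solutionZ (-1) snz)).
have s2 := free_solutionZ a2 sz.
have L := sqint_cexp x0 z0.
have [|||||T [T1 T2 T3]] := broken_solution x00 s1 s2.
- by rewrite rmorph0 !mulr0 cexp0; ring.
- by rewrite /a1 /a2; ring.
- by apply: sqintZ => //; exact: mitv.
- by do 2 (apply: sqintZ; first exact: mitv).
- move=> e e0; set k := cabs (a2 * z).
  have k1 : 0 < k + 1 by rewrite ltr_wpDl ?cabs_ge0.
  have [N HN] := expR_small z0 (divr_gt0 e0 k1).
  exists N => x Nx; rewrite mulrA cabsM -/k cabs_cexp.
  have -> : complex.Re (z * x%:C) = complex.Re z * x by rewrite cReM /= mulr0 subr0.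
  apply: le_trans (ler_wpM2l (cabs_ge0 _) (HN _ Nx)) _.
  by rewrite mulrCA ler_piMr ?(ltW e0)// ler_pdivrMr// mul1r lerDl.
exists T; split.
- by move=> y yx; rewrite T1// mulN1r.
- by move=> y xy; rewrite T2.
move=> u; rewrite T3.
have E := cexpNK (z * x0%:C).
rewrite -[RHS]mulr1; congr (_ * _).
transitivity ((2 * z)^-1 * (2 * z * (cexp (z * x0%:C) * cexp (- (z * x0%:C))))).
  by rewrite /a1 /a2 !mulNr; ring.
by rewrite E mulr1 mulVf// mulf_neq0// pnatr_eq0.
Qed.

Lemma cexp_cmul_real z x : cabs (cexp (z * x%:C)) = expR (complex.Re z * x).
Proof. by rewrite cabs_cexp cReM /= mulr0 subr0. Qed.

Lemma cexp2_sub1 z x : cexp (2 * z * x%:C) - 1 =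
  cexp (z * x%:C) * (cexp (z * x%:C) - cexp (- z * x%:C)).
Proof.
rewrite mulrBr mulNr cexpNK -cexpD; congr (cexp _ - 1); ring.
Qed.

(** Let [p] and [q] be the smaller and the larger of [x0] and [y]. Then [T y = e^(z q) (e^(z p) -
    e^(- z p)) / (2 z)], and since [Re z < 0], replacing [q] by [p] in the first factor only
    increases the modulus; the result is a diagonal value. *)
Lemma green_le z x0 y T (M : R) : complex.Re z < 0 -> 0 <= x0 -> 0 <= y ->
  (forall y, y <= x0 -> T y = (2 * z)^-1 * cexp (z * x0%:C) * (cexp (z * y%:C) - cexp
    (- z * y%:C))) ->
  (forall y, x0 <= y -> T y = (2 * z)^-1 * (cexp (z * x0%:C) - cexp (- z * x0%:C)) *
    cexp (z * y%:C)) ->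
  (forall t : R, 0 <= t -> cabs (cexp (2 * z * t%:C) - 1) <= M) ->
  cabs (T y) <= M / (2 * cabs z).
Proof.
move=> z0 x00 y0 T1 T2 HM.
have c2 : cabs ((2 * z)^-1) = (2 * cabs z)^-1.
  rewrite cabsV cabsM; congr (_ * _)^-1.
  by rewrite (_ : 2 = 2%:C) ?cabsR ?ger0_norm// rmorph_nat.
have c20 : 0 <= (2 * cabs z)^-1 by rewrite invr_ge0 mulr_ge0 ?cabs_ge0.
rewrite [M / _]mulrC; have [yx|xy] := leP y x0.
  rewrite T1// -mulrA cabsM c2 ler_wpM2l//.
  apply: le_trans (HM _ y0); rewrite cexp2_sub1 !cabsM ler_wpM2r ?cabs_ge0//.
  by rewrite !cexp_cmul_real ler_expR ler_wnM2l// ltW.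
rewrite T2 ?(ltW xy)// -mulrA cabsM c2 ler_wpM2l//.
apply: le_trans (HM _ x00); rewrite cexp2_sub1 !cabsM mulrC ler_wpM2r ?cabs_ge0//.
by rewrite !cexp_cmul_real ler_expR ler_wnM2l ?(ltW xy)// ltW.
Qed.

Lemma eigenvalue_bound V z (M v : R) : complex.Re z < 0 ->
  (forall t : R, 0 <= t -> cabs (cexp (2 * z * t%:C) - 1) <= M) ->
  is_eigenvalue V (- z ^+ 2) -> cm_variation V D = v%:E ->
  1 <= M / (2 * cabs z) * v.
Proof.
move=> z0 HM [psi [[x1 x10 psix1] /schrodinger_opP H]] Vv.
have M0 : 0 <= M by exact: le_trans (cabs_ge0 _) (HM 0 (lexx 0)).
have [K K0 HK] := H10_bounded psi.
set X := [set cabs (psi x) | x in [set x | 0 <= x]].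
have Xub : has_ubound X by exists K => _ [x x0 <-]; exact: HK.
set S := sup X.
have XS x : 0 <= x -> cabs (psi x) <= S by move=> x0; apply: ub_le_sup => //; exists x.
have S0 : 0 < S.
  apply: lt_le_trans (XS _ (ltW x10)).
  by rewrite lt_def cabs_eq0 psix1 cabs_ge0.
set k := M / (2 * cabs z).
have k0 : 0 <= k by rewrite divr_ge0// mulr_ge0 ?cabs_ge0.
have pt x0 : 0 <= x0 -> cabs (psi x0) <= S * (k * v).
  move=> x00; have [T [T1 T2 T3]] := green_function z0 x00.
  have := H T; rewrite T3 => ->; rewrite mulrA.
  apply: cm_integral_le => //.
  - by apply: cmeasurableM; [have [] := H10_sqint psi|have [] := H10_sqint T].
  - by rewrite mulr_ge0// ltW.
  move=> y /=; rewrite in_itv/= andbT => y0.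
  rewrite cabsM; apply: ler_pM; rewrite ?cabs_ge0 ?XS ?(ltW y0)//.
  exact: (green_le z0 x00 (ltW y0) T1 T2 HM).
(* The bound [pt] is uniform in the point, so it passes to the supremum, and [S > 0] can be
   cancelled. *)
have : S <= S * (k * v).
  by apply: ge_sup; [exists (cabs (psi x1)), x1 => //=;
    exact: ltW|move=> _ [x x0 <-]; exact: pt].
by rewrite ler_pMr.
Qed.

Lemma delta_weak c b u lam : 0 < b ->
  schrodinger_op (cdelta c (b : measurableTypeR R)) u (fun x => lam * u x) <->
  forall T, cintegral mu D (pairing lam u T) = c * (u b * T b).
Proof.
move=> b0.
have cE T : cm_integral (cdelta c (b : measurableTypeR R)) D (fun x =>
  u x * T x) = c * (u b * T b).
  rewrite cm_integral_delta//.
  by apply: cmeasurableM; [have [] := H10_sqint u|have [] := H10_sqint T].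
by rewrite schrodinger_opP; split => H T; rewrite H cE.
Qed.

Lemma delta_eigenvalue c b z : complex.Re z < 0 -> 0 < b ->
  is_eigenvalue (cdelta c (b : measurableTypeR R)) (- z ^+ 2) <->
  c * (cexp (2 * z * b%:C) - 1) = 2 * z.
Proof.
move=> z0 b0.
have zn : z != 0 by apply/eqP => zE; move: z0; rewrite zE ltxx.
have z2n : 2 * z != 0 by rewrite mulf_neq0// pnatr_eq0.
have [G [G1 _ G3]] := green_function z0 (ltW b0).
have Gb : 2 * z * G b = cexp (2 * z * b%:C) - 1.
  by rewrite G1// cexp2_sub1 !mulrA mulfV// mul1r.
split.
  move=> [psi [[x1 x10 psix1] /(delta_weak _ _ _ b0) H]].
  have psib : psi b != 0.
    apply/eqP => pb; have [T [_ _ T3]] := green_function z0 (ltW x10).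
    by have := H T; rewrite T3 pb mul0r mulr0 => E; rewrite E eqxx in psix1.
  have := H G; rewrite G3 -Gb => E.
  have : psi b * 1 = psi b * (c * G b) by rewrite mulr1 {1}E; ring.
  by move=> /(mulfI psib) E1; rewrite mulrCA -E1 mulr1.
move=> E.
have cG : c * G b = 1.
  by apply: (mulfI z2n); rewrite mulr1 -[RHS]E -Gb; ring.
exists G; split.
  exists b => //; apply/eqP => Gb0; move: cG; rewrite Gb0 mulr0 => /eqP.
  by rewrite eq_sym oner_eq0.
(* By symmetry of [pairing], [G] becomes the test function again and evaluates [T] at [b]. *)
apply/delta_weak => // T; rewrite mulrA cG mul1r -[RHS]G3.
by apply: eq_cintegral => x _; rewrite /pairing; ring.
Qed.

(** * Absence of eigenvalues in [[0, +oo[] for a point mass *)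

Lemma cderive_real (F f : R -> R) : (forall x, is_derive x 1 F (f x)) ->
  cderive (fun x => (F x)%:C) (fun x => (f x)%:C).
Proof. by move=> H; split => x /=; [exact: H|exact: is_derive_cst]. Qed.

(* The solution of [- v'' = k^2 v] with [v(0) = 0] and [v'(0) = 1]. *)
Definition sinc_primitive (k t : R) : R := if k == 0 then t else sin (k * t) / k.

Lemma is_derive_sinc_primitive (k s p : R) x :
  is_derive x 1 (fun x => sinc_primitive k (s * (x - p))) (s * cos (k * (s * (x - p)))).
Proof.
rewrite /sinc_primitive; have [->|k0] := eqVneq k 0.
  by apply: is_derive_eq; rewrite /GRing.scale/= mul0r cos0; ring.
by apply: is_derive_eq; rewrite /GRing.scale/=; field.
Qed.

Lemma is_derive_cos_affine (k s p : R) x :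
  is_derive x 1 (fun x =>
    s * cos (k * (s * (x - p)))) (- (k * s) ^+ 2 * sinc_primitive k (s * (x - p))).
Proof.
rewrite /sinc_primitive; have [->|k0] := eqVneq k 0.
  by apply: is_derive_eq; rewrite /GRing.scale/= !mul0r; ring.
by apply: is_derive_eq; rewrite /GRing.scale/=; field.
Qed.

(** The sign [s] orients the solution: [1] gives the left flank of a hat, leaving its zero at [p],
    and [-1] the right flank, arriving at its zero at [p]. *)
Lemma free_solution_sinc (k s p : R) : s ^+ 2 = 1 ->
  free_solution (k ^+ 2)%:C (fun x => (sinc_primitive k (s * (x - p)))%:C)
    (fun x => (s * cos (k * (s * (x - p))))%:C).
Proof.
move=> s1; split; first by apply: cderive_real => x; exact: is_derive_sinc_primitive.
apply: eq_cderive (cderive_real (is_derive_cos_affine k s p)) => // x.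
by rewrite exprMn s1 mulr1 rmorphM rmorphN.
Qed.

(** The flanks are mirror images meeting at [p + L], with slope jump [2 cos (k * L)]. If the test
    function misses the point mass, the weak equation becomes the recurrence
    [u(p) + u(p + 2 L) = 2 cos (k L) u(p + L)]. *)
Lemma hat_function (k p L : R) : 0 <= p -> 0 <= L -> exists T,
  (forall x, x <= p -> T x = 0) /\
  forall u, cintegral mu D (pairing (k ^+ 2)%:C u T) =
    u (p + L) * (2 * cos (k * L))%:C - u p - u (p + 2 * L).
Proof.
move=> p0 L0.
have s1 : (1 : R) ^+ 2 = 1 by rewrite expr1n.
have sN1 : (-1 : R) ^+ 2 = 1 by rewrite sqrrN expr1n.
have S0 : sinc_primitive k 0 = 0 :> R
  by rewrite /sinc_primitive mulr0 sin0 mul0r if_same.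
have [|||||T [T1 T2]] := @hat_solution _ _ _ _ _ _ p (p + L) (p + 2 * L) p0 _ _
  (free_solution_sinc k p s1) (free_solution_sinc k (p + 2 * L) sN1).
- by rewrite lerDl.
- lra.
- by rewrite subrr mulr0 S0.
- by congr (_%:C); congr sinc_primitive; ring.
- by rewrite subrr mulr0 S0.
exists T; split => // u; rewrite T2 !subrr !mulr0 cos0.
rewrite (_ : 1 * (p + L - p) = L); last by ring.
rewrite (_ : -1 * (p + L - (p + 2 * L)) = L); last by ring.
by rewrite !mulr1 mulN1r mul1r rmorphN opprK -rmorphD -mulr2n mulr_natl rmorphN
  rmorph1; ring.
Qed.

(* For [k > 0] the choice [cos (k * L) = 0] makes [|u|] periodic, for [k = 0] one
   lets [L] tend to infinity; in both cases [u] decays. *)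
Lemma recurrence_vanish (k p0 : R) u : 0 <= p0 -> 0 <= k ->
  (forall p L, p0 <= p -> 0 <= L ->
    u (p + L) * (2 * cos (k * L))%:C - u p - u (p + 2 * L) = 0) ->
  forall p, p0 <= p -> u p = 0.
Proof.
move=> p00 k0 rec p pp.
apply/eqP; rewrite -cabs_eq0 eq_le cabs_ge0 andbT; apply/ler_addgt0Pr => e e0.
have [kz|kn] := eqVneq k 0.
  have e30 : 0 < e / 3 by rewrite divr_gt0.
  have [N HN] := H10_decay u e30.
  set L := Num.max 0 (N - p).
  have L0 : 0 <= L by rewrite le_max lexx.
  have NL : N <= p + L by rewrite -lerBlDl le_max lexx orbT.
  have := rec _ _ pp L0; rewrite kz mul0r cos0 mulr1.
  have -> : u (p + L) * 2%:C - u p - u (p + 2 * L) = (u (p + L) + u (p + L) - u (p +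
    2 * L)) - u p.
    by rewrite rmorph_nat; ring.
  move=> /eqP; rewrite subr_eq0 => /eqP <-; rewrite add0r.
  apply: le_trans (cabsD _ _) _; apply: le_trans (lerD (cabsD _ _) (lexx _)) _.
  rewrite cabsN; have h1 := HN _ NL.
  have h2 : cabs (u (p + 2 * L)) <= e / 3 by apply: HN; lra.
  lra.
have kp : 0 < k by rewrite lt_def kn.
have pi0 := @pi_gt0 R.
set L := pi / 2 / k.
have L0 : 0 < L by rewrite !divr_gt0.
have per q : p0 <= q -> cabs (u (q + 2 * L)) = cabs (u q).
  move=> qq; have := rec _ _ qq (ltW L0).
  rewrite /L mulrCA divff// mulr1 cos_pihalf mulr0 mulr0 sub0r => /eqP.
  by rewrite subr_eq0 => /eqP <-; rewrite cabsN.
have pern n : cabs (u (p + n%:R * (2 * L))) = cabs (u p).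
  elim: n => [|n <-]; first by rewrite mul0r addr0.
  rewrite -[RHS]per; last by rewrite (le_trans pp)// lerDl mulr_ge0// mulr_ge0// ltW.
  by congr (cabs (u _)); rewrite -natr1; ring.
have [N HN] := H10_decay u e0.
have L20 : 0 < 2 * L by rewrite mulr_gt0.
rewrite add0r -(pern (Num.bound (`|N| / (2 * L)))); apply: HN.
apply: (@le_trans _ _ `|N|); first exact: ler_norm.
rewrite -[leLHS](@divfK _ (2 * L)) ?gt_eqF//.
apply: ler_wpDl; first exact: le_trans pp.
rewrite ler_pM2r// ltW// archi_boundP// divr_ge0//; exact: ltW.
Qed.

(** Hats starting at [p >= b] vanish at [b], so the recurrence holds beyond [b] and [psi] vanishes
    on [[b, +oo[]. Then [psi b = 0] removes the point mass from the equation altogether, and the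
    same argument started at [0] kills [psi]. *)
Lemma delta_no_nonneg_eigenvalue c b (k : R) : 0 < b -> 0 <= k ->
  ~ is_eigenvalue (cdelta c (b : measurableTypeR R)) (k ^+ 2)%:C.
Proof.
move=> b0 k0 [psi [[x1 x10 psix1] /(delta_weak _ _ _ b0) H]].
have far p : b <= p -> psi p = 0.
  apply: (recurrence_vanish (ltW b0) k0) => q L bq L0.
  have [T [T1 T2]] := hat_function k (le_trans (ltW b0) bq) L0.
  by rewrite -T2 H T1// !mulr0.
have : psi x1 = 0.
  apply: (recurrence_vanish (lexx 0) k0) (ltW x10) => q L q0 L0.
  have [T [T1 T2]] := hat_function k q0 L0.
  by rewrite -T2 H far// mul0r mulr0.
by move=> E; rewrite E eqxx in psix1.
Qed.

Lemma nonneg_or_square lam :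
  (exists2 k : R, 0 <= k & lam = (k ^+ 2)%:C) \/
  (exists2 z, complex.Re z < 0 & lam = - z ^+ 2).
Proof.
set w := sqrtc (- lam).
have wE : w ^+ 2 = - lam by exact: sqr_sqrtc.
have [w0|w0|w0] := ltgtP (complex.Re w) 0.
- by right; exists w => //; rewrite wE opprK.
- by right; exists (- w); [case: (w) w0 => a b /=;
  rewrite oppr_lt0|rewrite sqrrN wE opprK].
left; exists `|complex.Im w| => //.
rewrite real_normK ?num_real// -[LHS]opprK -wE.
by apply: complex_ext; case: (w) w0 => a b /= ->; rewrite ?expr2 /=; ring.
Qed.

Lemma delta_spectrum c b lam : 0 < b ->
  is_eigenvalue (cdelta c (b : measurableTypeR R)) lam <->
  exists z, [/\ complex.Re z < 0,
    lam = - z ^+ 2 & c * (cexp (2 * z * b%:C) - 1) = 2 * z].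
Proof.
move=> b0; split.
  have [[k k0 ->] /delta_no_nonneg_eigenvalue//|[z z0 ->]] := nonneg_or_square lam.
    by move=> /(_ b0 k0).
  by move=> /(delta_eigenvalue _ z0 b0) E; exists z.
by move=> [z [z0 -> /(delta_eigenvalue _ z0 b0)]].
Qed.

End green.

(** * Sharpness *)

Section sharpness.
Context {R : realType}.
Implicit Types (a b m y t theta : R) (c z w : R[i]).

(** With [w = - y + i a y], the number [e^w - 1] is [e^(i a y)] times the conjugate of
    [e^(- y) - e^(i a y)]; this is how [g] enters the bound. *)
Lemma gfun_cexp a y : cabs (cexp ((- y) +i* (a * y)) - 1) = gfun a y.
Proof.
apply/eqP; rewrite -(eqrXn2 (n := 2))// ?cabs_ge0 ?gfun_ge0// gfun_sqr cabs_sqr /=.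
apply/eqP; have := cos2Dsin2 (a * y); set C := cos _; set S := sin _;
  set E := expR _ => CS.
transitivity (1 - 2 * E * C + E ^+ 2 * (C ^+ 2 + S ^+ 2)); first by ring.
by rewrite CS mulr1.
Qed.

Lemma cot_half_mul theta r : 0 < theta < 2 * pi ->
  cot (theta / 2) * (r * sin (theta / 2)) = r * cos (theta / 2).
Proof.
move=> /andP[t0 t1]; rewrite /cot; have : sin (theta / 2) != 0.
  by rewrite gt_eqF// sin_gt0_pi//; apply/andP; split; lra.
by move=> s0; field.
Qed.

(* [i] times the square root of [r^2 e^(i theta)] in the upper half-plane. *)
Definition zroot (r theta : R) : R[i] :=
  (- (r * sin (theta / 2))) +i* (r * cos (theta / 2)).

Lemma zroot_Re r theta : 0 < r -> 0 < theta < 2 * pi -> complex.Re (zroot r theta) < 0.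
Proof.
move=> r0 /andP[t0 t1]; rewrite /= oppr_lt0 mulr_gt0// sin_gt0_pi//.
by apply/andP; split; lra.
Qed.

Lemma zroot_sqr r theta : - zroot r theta ^+ 2 = (r ^+ 2)%:C * expi theta.
Proof.
rewrite {2}(splitr theta).
by apply: complex_ext; rewrite /= ?cosD ?sinD; ring.
Qed.

Lemma cabs_zroot r theta : 0 <= r -> cabs (zroot r theta) = r.
Proof.
move=> r0; apply/eqP; rewrite -(eqrXn2 (n := 2))// ?cabs_ge0// cabs_sqr /=.
apply/eqP; transitivity (r ^+ 2 * (cos (theta / 2) ^+ 2 + sin (theta / 2) ^+ 2));
  first by ring.
by rewrite cos2Dsin2 mulr1.
Qed.

Lemma zroot_scaled r theta t : 0 < theta < 2 * pi ->
  2 * zroot r theta * t%:C =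
  (- (2 * r * t * sin (theta / 2))) +i* (cot (theta / 2) * (2 * r * t * sin (theta /
    2))).
Proof.
move=> th; rewrite cot_half_mul//.
by rewrite mulr_natl mulr2n; apply: complex_ext => /=; ring.
Qed.

Lemma zroot_cexp_le r theta t : 0 <= r -> 0 < theta < 2 * pi -> 0 <= t ->
  cabs (cexp (2 * zroot r theta * t%:C) - 1) <= g (cot (theta / 2)).
Proof.
move=> r0 th t0; rewrite zroot_scaled// gfun_cexp; apply: gfun_le_g.
move: th => /andP[th0 th1].
by rewrite !mulr_ge0// sin_ge0_pi//; apply/andP; split; lra.
Qed.

Lemma cm_variation_ge0 (V : complex_measure (measurableTypeR R) R) :
  (0 <= cm_variation V (halfline R))%E.
Proof.
apply: (@le_trans _ _ (cabs (cm_val V (halfline R)))%:E); first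
  by rewrite lee_fin cabs_ge0.
apply: ereal_sup_ubound; exists 1%N, (fun=> halfline R); split.
- by move=> _; exact: mitv.
- by move=> i j _ _ _; rewrite !ord1.
- by apply/seteqP; split => [x []//|x Dx]; exists ord0.
- by rewrite big_ord1.
Qed.

Lemma eigenvalue_sqrt_le (V : complex_measure (measurableTypeR R) R) (lam : R[i])
  theta :
  0 < theta < 2 * pi -> lam = (cabs lam)%:C * expi theta ->
  ~~ (0 <= lam) -> is_eigenvalue V lam ->
  ((Num.sqrt (cabs lam))%:E <=
     (2^-1 * g (cot (theta / 2)))%:E * cm_variation V (halfline R))%E.
Proof.
move=> th lamE lamN eig.
have g0 := g_gt0 (cot (theta / 2)).
have lam0 : 0 < cabs lam.
  by rewrite lt_def cabs_ge0 andbT cabs_eq0; apply: contraNneq lamN => ->.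
set r := Num.sqrt (cabs lam).
have r0 : 0 < r by rewrite sqrtr_gt0.
have zE : lam = - zroot r theta ^+ 2.
  by rewrite zroot_sqr sqr_sqrtr ?(ltW lam0).
have := cm_variation_ge0 V; case VE : (cm_variation V (halfline R)) => [v| |] // v0.
  rewrite zE in eig.
  have := eigenvalue_bound (zroot_Re r0 th) (fun t =>
    @zroot_cexp_le r theta t (ltW r0) th) eig VE.
  rewrite cabs_zroot ?(ltW r0)// => h.
  rewrite -EFinM lee_fin -[leLHS]mulr1.
  apply: le_trans (ler_wpM2l (ltW r0) h) _.
  rewrite le_eqVlt; apply/orP; left; apply/eqP; field.
  by rewrite gt_eqF.
(* A variation equal to [+oo] makes the right-hand side infinite because [g] is positive. *)
by rewrite mulry gtr0_sg ?mul1e ?leey// mulr_gt0.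
Qed.

Lemma eigenvalue_sqrt_le_L1 (v : L1_potential R) (lam : R[i]) theta :
  0 < theta < 2 * pi -> lam = (cabs lam)%:C * expi theta ->
  ~~ (0 <= lam) -> is_eigenvalue (measure_of_L1 v) lam ->
  Num.sqrt (cabs lam) <= 2^-1 * g (cot (theta / 2)) * L1_norm v.
Proof.
move=> th lamE lamN eig; rewrite -lee_fin.
apply: le_trans (eigenvalue_sqrt_le th lamE lamN eig) _.
rewrite [leRHS]EFinM lee_wpmul2l//; last exact: cm_variation_of_L1.
by rewrite lee_fin mulr_ge0// ltW// g_gt0.
Qed.

Lemma cexp_divdiff_inj a y w : 0 < a -> 0 < y ->
  cos (a * y) + a * sin (a * y) = expR (- y) -> pi / 2 < a * y < pi ->
  complex.Re w < 0 ->
  (cexp w - 1) * ((- y) +i* (a * y)) = (cexp ((- y) +i* (a * y)) - 1) * w ->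
  w = (- y) +i* (a * y).
Proof.
move=> a0 y0 crit /andP[t1 t2].
set t := a * y in crit t1 t2 *; set w0 := (- y) +i* t.
case: w => p q /= p0 E.
(* By [crit], [(e^w0 - 1) / w0 = r e^(i al)] with [r = sin t / y], and [pi / 2 < t < pi] places [al]
   in []0, pi / 2[]. *)
set al := t - pi / 2.
have ca : cos al = sin t by rewrite /al cosBpihalf.
have sa : sin al = - cos t by rewrite /al sinBpihalf.
set r := sin t / y.
have ry : r * y = cos al by rewrite ca /r divfK// gt_eqF.
have rt : r * (al + pi / 2) = sin al + expR (- y).
  rewrite /al subrK sa -crit /r /t; field; rewrite gt_eqF//.
have w0n : w0 != 0.
  by apply/eqP => /(congr1 (@complex.Re R))/eqP; rewrite /= oppr_eq0 gt_eqF.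
have cs := cos2Dsin2 t.
have rt' : r * t = expR (- y) - cos t by move: rt; rewrite /al subrK sa; lra.
have ry' : r * y = sin t by rewrite ry ca.
have ne : cexp w0 - 1 = (r * cos al +i* (r * sin al)) * w0.
  apply: complex_ext; rewrite ?cReM ?cImM ca sa /=.
    transitivity (- ((r * y) * sin t) + (r * t) * cos t); last by ring.
    by rewrite rt' ry'; move: cs; rewrite !expr2 => cs; lra.
  transitivity ((r * t) * sin t + (r * y) * cos t); last by ring.
  by rewrite rt' ry'; ring.
have E' : cexp (p +i* q) - 1 = (r * cos al +i* (r * sin al)) * (p +i* q).
  by apply: (mulIf w0n); rewrite E ne; ring.
have [Er Ei] : expR p * cos q - 1 = r * cos al * p - r * sin al * q /\
    expR p * sin q = r * cos al * q + r * sin al * p.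
  split; first by have := congr1 (@complex.Re R) E'; rewrite cReM.
  by have := congr1 (@complex.Im R) E'; rewrite cImM /= subr0.
have csa := cos2Dsin2 al.
have [||||||||] := @critical_unique R al y r (- p) q.
- by rewrite /al subr_gt0.
- by rewrite /al; lra.
- by [].
- by rewrite oppr_gt0.
- exact: ry.
- exact: rt.
(* The real part of [e^(- i al) (e^w - 1) = r w]; the next goal is its imaginary part. *)
- rewrite opprK cosB.
  transitivity (cos al - (cos al * (expR p * cos q - 1) + sin al * (expR p * sin q))
    - cos al); last by ring.
  rewrite Er Ei.
  transitivity (- (r * p) * (cos al ^+ 2 + sin al ^+ 2)); last by ring.
  by rewrite csa; ring.
- rewrite opprK sinB.
  transitivity (sin al + (cos al * (expR p * sin q) - sin al * (expR p * cos q - 1))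
    - sin al); last by ring.
  rewrite Er Ei.
  transitivity ((r * q) * (cos al ^+ 2 + sin al ^+ 2)); last by ring.
  by rewrite csa; ring.
by move=> pE ->; rewrite /w0 -pE opprK /al subrK.
Qed.

Lemma delta_optimal m theta : 0 < m -> 0 < theta < pi ->
  exists c b, [/\ 0 < b, cabs c = m & forall z, complex.Re z < 0 ->
    c * (cexp (2 * z * b%:C) - 1) = 2 * z <->
    z = zroot (m / 2 * g (cot (theta / 2))) theta].
Proof.
move=> m0 /andP[th0 th1].
have th : 0 < theta < 2 * pi by apply/andP; split => //; lra.
have s0 : 0 < sin (theta / 2) by rewrite sin_gt0_pi//; apply/andP; split; lra.
have c0 : 0 < cos (theta / 2) by rewrite cos_gt0_pihalf//; apply/andP; split; lra.
set a := cot (theta / 2).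
have a0 : 0 < a by rewrite divr_gt0.
have [y [y0 gE crit tpi]] := g_attained a0.
have g0 := g_gt0 a.
set r := m / 2 * g a.
have r0 : 0 < r by rewrite mulr_gt0// divr_gt0.
(* This [b] makes [2 * z0 * b] the maximizer [- y + i a y]. *)
set b := y / (2 * r * sin (theta / 2)).
have b0 : 0 < b by rewrite divr_gt0// !mulr_gt0.
set z0 := zroot r theta.
have w0E : 2 * z0 * b%:C = (- y) +i* (a * y).
  rewrite zroot_scaled// -/a (_ : 2 * r * b * sin (theta / 2) = y)// /b.
  by field; rewrite !gt_eqF.
set w0 := (- y) +i* (a * y) in w0E.
have w0n : w0 != 0.
  by apply/eqP => /(congr1 (@complex.Re R))/eqP; rewrite /= oppr_eq0 gt_eqF.
have en : cexp w0 - 1 != 0.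
  by rewrite -cabs_eq0 gfun_cexp -gE gt_eqF.
have bn : b%:C != 0 by apply/eqP => /(congr1 (@complex.Re R))/eqP; rewrite /= gt_eqF.
(* The eigenvalue equation at [z0] forces this [c]; its modulus is [2 r / g a = m]. *)
exists (2 * z0 / (cexp w0 - 1)), b; split => //.
  rewrite cabsM cabsV gfun_cexp -gE cabsM cabs_zroot ?(ltW r0)//.
  rewrite (_ : cabs 2 = 2); first by rewrite /r; field; rewrite gt_eqF.
  by rewrite -[2 in LHS](rmorph_nat (real_complex R)) cabsR ger0_norm.
move=> z zneg; split => [E|->]; last by rewrite w0E divfK.
have wE : 2 * z * b%:C = w0.
  apply: (cexp_divdiff_inj a0 y0 crit tpi).
    rewrite cReM /= mulr0 subr0 nmulr_rlt0//.
    by rewrite mulr_natl mulr2n cReD; lra.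
  have E2 : (cexp (2 * z * b%:C) - 1) * (2 * z0) = (cexp w0 - 1) * (2 * z).
    transitivity (2 * z0 / (cexp w0 - 1) * (cexp w0 - 1) * (cexp (2 * z * b%:C) - 1)).
      by rewrite divfK// mulrC.
    by rewrite -[X in _ = _ * X]E; ring.
  by rewrite -/w0 -[X in _ * X = _]w0E mulrA E2 -mulrA.
have n2 : 2 != 0 :> R[i] by rewrite pnatr_eq0.
by move: wE; rewrite -w0E => /(mulIf bn)/(mulfI n2).
Qed.


Lemma cexpJ z : cexp z^* = (cexp z)^*.
Proof. by case: z => p q; apply: complex_ext; rewrite /= ?cosN ?sinN ?mulrN. Qed.

Lemma zrootJ r theta : (zroot r (2 * pi - theta))^* = zroot r theta.
Proof.
rewrite /zroot (_ : (2 * pi - theta) / 2 = pi - theta / 2); last by field.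
by apply: complex_ext; rewrite /= ?sinB ?cosB sinpi cospi; ring.
Qed.

(** Conjugating the eigenvalue equation conjugates both [c] and [z]. This takes [theta] to
    [2 pi - theta] and changes the sign of the cotangent, under which [g] is even. *)
Lemma delta_optimal_reflect m theta : 0 < m -> pi < theta < 2 * pi ->
  exists c b, [/\ 0 < b, cabs c = m & forall z, complex.Re z < 0 ->
    c * (cexp (2 * z * b%:C) - 1) = 2 * z <->
    z = zroot (m / 2 * g (cot (theta / 2))) theta].
Proof.
move=> m0 /andP[th0 th1]; have pi0 := @pi_gt0 R.
have [|c [b [b0 cm H]]] := @delta_optimal m (2 * pi - theta) m0.
  by apply/andP; split; lra.
exists c^*%C, b; split => //; first by rewrite cabsJ.
move=> z z0; have zJ0 : complex.Re z^*%C < 0 by rewrite cReJ.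
have gE : g (cot ((2 * pi - theta) / 2)) = g (cot (theta / 2)).
  rewrite -[RHS]gN; congr g.
  rewrite /cot (_ : (2 * pi - theta) / 2 = pi - theta / 2); last by field.
  by rewrite sinB cosB sinpi cospi !mul0r mulN1r addr0 sub0r mulN1r opprK mulNr.
have := H _ zJ0; rewrite gE => HJ.
have cM (u v : R[i]) : (u * v)^*%C = u^*%C * v^*%C by rewrite rmorphM.
have cB (u : R[i]) : (u - 1)^*%C = u^*%C - 1 by rewrite rmorphB rmorph1.
have conjE : c^*%C * (cexp (2 * z * b%:C) - 1) = 2 * z <->
    c * (cexp (2 * z^*%C * b%:C) - 1) = 2 * z^*%C.
  have e1 : (c * (cexp (2 * z^*%C * b%:C) - 1))^*%C = c^*%C * (cexp (2 * z * b%:C) - 1).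
    by rewrite cM cB -cexpJ !cM conjcK conjc_real conjc_nat.
  have e2 : (2 * z^*%C)^*%C = 2 * z by rewrite cM conjcK conjc_nat.
  by split => [E|E]; [apply: (can_inj (@conjcK R)); rewrite e1 e2|rewrite -e1 E e2].
rewrite conjE HJ; split => [E|->].
  by rewrite -(zrootJ _ theta) -E conjcK.
by rewrite -zrootJ conjcK.
Qed.

Lemma delta_spectrum_optimal c b r theta lam : 0 < b -> 0 < r -> 0 < theta < 2 * pi ->
  (forall z, complex.Re z < 0 ->
    c * (cexp (2 * z * b%:C) - 1) = 2 * z <-> z = zroot r theta) ->
  is_eigenvalue (cdelta c (b : measurableTypeR R)) lam <->
  lam = (r ^+ 2)%:C * expi theta.
Proof.
move=> b0 r0 th H; rewrite delta_spectrum//; split.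
  by move=> [z [z0 -> /(H _ z0) ->]]; exact: zroot_sqr.
move=> ->; have z0 := zroot_Re r0 th.
by exists (zroot r theta); split => //; [rewrite zroot_sqr|apply/(H _ z0)].
Qed.

(** * The negative half-axis, [theta = pi] *)

Lemma normr_sin_le t : `|sin t| <= `|t|.
Proof.
wlog t0 : t / 0 <= t.
  move=> H; have [t0|t0] := leP 0 t; first exact: H.
  by rewrite -normrN -sinN -(normrN t); apply: H; lra.
rewrite (ger0_norm t0); have [h|h] := leP t (pi / 2).
  rewrite ger0_norm ?sin_le_id// sin_ge0_pi//; apply/andP; split => //.
  by have := @pi_gt0 R; lra.
by apply: le_trans (sin_max _) _; have := @pi_ge2 R; lra.
Qed.

(* The last two equations say that [k (e^w - 1) = w] for [w = - y' + i t']. *)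
Lemma real_coupling_unique (k y y' t' : R) : 0 < k -> 0 < y -> 0 < y' ->
  k * (1 - expR (- y)) = y ->
  k * (expR (- y') * cos t' - 1) = - y' -> k * (expR (- y') * sin t') = t' ->
  y' = y /\ t' = 0.
Proof.
move=> k0 y0 y'0 ky kr ki.
have e'0 := expR_gt0 (- y').
have ee (x : R) : 0 < x -> expR (- x) * (1 + x) < 1.
  by move=> x0; rewrite expRN mulrC ltr_pdivrMr ?expR_gt0// mul1r expR_gt1Dx// gt_eqF.
(* If [k * expR (- x) >= 1], then [k <= x + k * expR (- x) <= k * expR (- x) * (1 + x) < k]. *)
have small (x : R) : 0 < x -> k * (1 - expR (- x)) <= x -> k * expR (- x) < 1.
  move=> x0 kx; have := ee x x0; have e0 := expR_gt0 (- x).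
  set E := expR _ in kx e0 * => Ex; rewrite ltNge; apply/negP => kE.
  have : k * (E * (1 + x)) < k by rewrite -[ltRHS]mulr1 ltr_pM2l.
  have : x <= k * E * x by rewrite ler_peMl// ltW.
  lra.
(* Otherwise [|t'| = k expR (- y') |sin t'| <= k expR (- y') |t'|] with a factor below one. *)
have t'0 : t' = 0.
  apply/eqP/negPn/negP => t'n.
  have : k * expR (- y') < 1.
    apply: small => //.
    have : k * (expR (- y') * cos t') <= k * (expR (- y') * 1).
      by rewrite ler_pM2l// ler_pM2l// cos_le1.
    lra.
  have : `|t'| <= k * expR (- y') * `|t'|.
    rewrite -{1}ki mulrA normrM ger0_norm ?mulr_ge0 ?(ltW k0) ?(ltW e'0)//.
    by rewrite ler_wpM2l ?normr_sin_le// mulr_ge0 ?(ltW k0) ?(ltW e'0).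
  move=> h1 h2.
  have : k * expR (- y') * `|t'| < 1 * `|t'| by rewrite ltr_pM2r// normr_gt0.
  lra.
split => //.
have ky' : k * (1 - expR (- y')) = y' by move: kr; rewrite t'0 cos0; lra.
(* At a positive solution [u] the slope [k expR (- u)] of the concave left-hand side is below one,
   so that side stays strictly under the diagonal beyond [u]. *)
have decr (u v : R) : 0 < u -> u < v -> k * (1 - expR (- u)) = u ->
    k * (1 - expR (- v)) = v -> False.
  move=> u0 uv ku kv.
  have h1 : k * expR (- u) < 1 by apply: small => //; rewrite ku.
  have e0 := expR_gt0 (- u).
  have h2 : expR (- u) * (1 - (v - u)) <= expR (- v).
    have -> : expR (- v) = expR (- u) * expR (- (v - u))
      by rewrite -expRD; congr expR; ring.
    by rewrite ler_pM2l//; exact: expR_ge1Dx.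
  have : k * (expR (- u) * (1 - (v - u))) <= k * expR (- v) by rewrite ler_pM2l.
  have : k * expR (- u) * (v - u) < 1 * (v - u) by rewrite ltr_pM2r// subr_gt0.
  lra.
have [yy|yy|//] := ltgtP y' y.
  by case: (decr _ _ y'0 yy ky' ky).
by case: (decr _ _ y0 yy ky ky').
Qed.

Lemma g0_le1 : g (0 : R) <= 1.
Proof.
apply: ge_sup; first by exists (gfun 0 0); exists 0 => //=.
move=> _ [y /= y0 <-]; rewrite -/(gfun 0 y).
rewrite -(ler_pXn2r (n := 2))// ?nnegrE ?gfun_ge0// gfun_sqr mul0r cos0 expr1n.
have e0 := expR_gt0 (- y).
have e1 : expR (- y) <= 1 by rewrite expR_le1 oppr_le0.
have : expR (- y) * expR (- y) <= expR (- y) * 1 by rewrite ler_pM2l.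
by rewrite expr2; lra.
Qed.

(** For [a = 0] the modulus [1 - e^(- y)] increases to [1], so equality would need an infinite [b].
    With the real coupling [m], every positive [r < m / 2] is reached at a finite [b]. *)
Lemma delta_optimal_pi m (eps : R) : 0 < m -> 0 < eps ->
  exists b r, [/\ 0 < b, 0 < r, m / 2 - eps < r & forall z, complex.Re z < 0 ->
    m%:C * (cexp (2 * z * b%:C) - 1) = 2 * z <-> z = zroot r pi].
Proof.
move=> m0 eps0.
have [r [r0 r1 r2]] : exists r, [/\ 0 < r, r < m / 2 & m / 2 - eps < r].
  (* The entry [m / 4] keeps [r] positive when [eps] is large. *)
  exists (Num.max (m / 4) (m / 2 - eps / 2)); split.
  - by rewrite lt_max; apply/orP; left; lra.
  - by rewrite gt_max; apply/andP; split; lra.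
  - by rewrite lt_max; apply/orP; right; lra.
set q := 1 - 2 * r / m.
have q0 : 0 < q by rewrite subr_gt0 ltr_pdivrMr//; lra.
have q1 : q < 1 by rewrite /q ltrBlDr ltrDl divr_gt0// mulr_gt0.
(* Solves [2 r = m (1 - e^(- 2 r b))]; [r] tends to [m / 2] as [b] grows. *)
set b := - ln q / (2 * r).
have b0 : 0 < b by rewrite divr_gt0 ?mulr_gt0// oppr_gt0 ln_lt0// q0.
set y := 2 * r * b.
have y0 : 0 < y by rewrite mulr_gt0// mulr_gt0.
have yE : expR (- y) = q.
  rewrite /y /b (_ : - (2 * r * (- ln q / (2 * r))) = ln q) ?lnK ?posrE//.
  by field; rewrite gt_eqF.
have ky : m * b * (1 - expR (- y)) = y.
  by rewrite yE /q /y; field; rewrite gt_eqF.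
have mb0 : 0 < m * b by rewrite mulr_gt0.
have zE : zroot r pi = (- r)%:C.
  by apply: complex_ext; rewrite /= ?sin_pihalf ?cos_pihalf; ring.
exists b, r; split => // z z0; rewrite zE; split.
  case: z z0 => p t /= p0 E.
  have wE : 2 * (p +i* t) * b%:C = (- (- (2 * p * b))) +i* (2 * t * b).
    by rewrite mulr_natl mulr2n; apply: complex_ext => /=; ring.
  (* Multiplying by [b] gives the equation in [w = 2 z b] with coupling [k = m b]. *)
  have Eb : (m * b)%:C * (cexp (2 * (p +i* t) * b%:C) - 1) = 2 * (p +i* t) * b%:C.
    by rewrite -[X in _ = X * _]E rmorphM; ring.
  rewrite wE in Eb.
  have [||||||pE tE] := @real_coupling_unique (m * b) y (- (2 * p * b)) (2 * t * b)
    => //.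
  - have : p * b < 0 by rewrite nmulr_rlt0.
    by lra.
  - by have := congr1 (@complex.Re R) Eb; rewrite /= mul0r subr0.
  - by have := congr1 (@complex.Im R) Eb; rewrite /= mul0r addr0 subr0.
  have bn : b != 0 by rewrite gt_eqF.
  apply: complex_ext => /=.
    by apply: (mulIf bn); move: pE; rewrite /y; lra.
  by apply: (mulIf bn); rewrite mul0r; lra.
move=> ->.
have -> : 2 * (- r)%:C * b%:C = (- y) +i* 0.
  by rewrite /y mulr_natl mulr2n; apply: complex_ext => /=; ring.
have mr : m * (expR (- y) - 1) = - (2 * r) by rewrite yE /q; field; rewrite gt_eqF.
rewrite mulr_natl mulr2n; apply: complex_ext => /=.
  by rewrite cos0 mulr1 mul0r subr0 mr; ring.
by rewrite sin0; ring.
Qed.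

End sharpness.

Unset Implicit Arguments.
Set Strict Implicit.
Set Printing Implicit Defensive.

Theorem theorem1p1 (R : realType) :
  [/\
      forall (V : complex_measure (measurableTypeR R) R) (lam : R[i]) (theta : R),
        0 < theta < 2 * pi -> lam = (cabs lam)%:C * expi theta ->
        ~~ (0 <= lam) -> is_eigenvalue V lam ->
        ((Num.sqrt (cabs lam))%:E <=
           (2^-1 * g (cot (theta / 2)))%:E * cm_variation V (halfline R))%E,
      forall (v : L1_potential R) (lam : R[i]) (theta : R),
        0 < theta < 2 * pi -> lam = (cabs lam)%:C * expi theta ->
        ~~ (0 <= lam) -> is_eigenvalue (measure_of_L1 v) lam ->
        Num.sqrt (cabs lam) <= 2^-1 * g (cot (theta / 2)) * L1_norm v,
      forall m theta : R, 0 < m -> 0 < theta < 2 * pi -> theta <> pi ->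
        exists (c : R[i]) (b : R),
          [/\ 0 < b, cabs c = m,
              cm_variation (cdelta c (b : measurableTypeR R)) (halfline R) = m%:E
            & forall lam : R[i],
                is_eigenvalue (cdelta c (b : measurableTypeR R)) lam <->
                lam = (m ^+ 2 / 4 * g (cot (theta / 2)) ^+ 2)%:C * expi theta]
    & (* sharpness at theta = pi, where the supremum g 0 is not attained:
         equality in the limit *)
      forall m eps : R, 0 < m -> 0 < eps ->
        exists (c : R[i]) (b : R) (r : R),
          [/\ 0 < b /\ cabs c = m,
              cm_variation (cdelta c (b : measurableTypeR R)) (halfline R) = m%:E,
              0 < r /\ 2^-1 * g (cot (pi / 2)) * m - eps < Num.sqrt r
            & forall lam : R[i],
                is_eigenvalue (cdelta c (b : measurableTypeR R)) lam <->
                lam = r%:C * expi pi]].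
Proof.
split.
- by move=> V lam theta; exact: eigenvalue_sqrt_le.
- by move=> v lam theta; exact: eigenvalue_sqrt_le_L1.
- move=> m theta m0 th thpi.
  have [c [b [b0 cm H]]] : exists c b, [/\ 0 < b, cabs c = m & forall z,
    complex.Re z < 0 ->
      c * (cexp (2 * z * b%:C) - 1) = 2 * z <->
      z = zroot (m / 2 * g (cot (theta / 2))) theta].
    move: th => /andP[th0 th1]; have [tp|tp|//] := ltgtP theta pi.
      by apply: delta_optimal => //; rewrite th0.
    by apply: delta_optimal_reflect => //; rewrite tp.
  exists c, b; split => //; first by rewrite cm_variation_delta// cm.
  move=> lam; rewrite (@delta_spectrum_optimal _ c b _ theta lam b0 _ th H); last first.
    by rewrite mulr_gt0 ?g_gt0// divr_gt0.
  by rewrite exprMn expr_div_n -natrX.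
- move=> m eps m0 eps0.
  have pi0 := @pi_gt0 R.
  have [b [r [b0 r0 mr H]]] := delta_optimal_pi m0 eps0.
  have thpi : 0 < (pi : R) < 2 * pi by apply/andP; split => //; lra.
  exists m%:C, b, (r ^+ 2); split.
  + by split => //; rewrite cabsR gtr0_norm.
  + by rewrite cm_variation_delta// cabsR gtr0_norm.
  + split; first by rewrite exprn_gt0.
    (* The square root is [r > m / 2 - eps], and [g 0 <= 1] bounds the left-hand side by
       [m / 2 - eps]. *)
    rewrite sqrtr_sqr gtr0_norm//; apply: le_lt_trans mr.
    rewrite lerD2r mulrAC [2^-1 * m]mulrC /cot cos_pihalf mul0r.
    by rewrite ler_piMr ?g0_le1// divr_ge0// ltW.
  + by move=> lam; exact: delta_spectrum_optimal.
Qed.
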